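(* Let $X$ be a connected weighted graph of bounded valency and finite total weight, with weight function $w$, and let $T$ be the linear operator on $\ell^2(\mathrm{OE})$ determined by $Te=\sum_{e'}w(e')e'$, the sum running over all oriented edges $e'$ with $o(e')=t(e)$ and $e'\neq e^{-1}$. Then $T$ is of trace class. The infinite product $Z(u)=\prod_p\left(1-w(p)u^{l(p)}\right)^{-1}$, extended over all regular prime cycles $p$ in $X$, converges for $|u|$ sufficiently small. The limit function extends to a meromorphic function on $\mathbb{C}$ without zeros; more precisely, the function $Z(u)^{-1}$ is entire and satisfies $$Z(u)^{-1}=\det(1-uT).$$
   Context: Graph: $X$ is a connected (simple, undirected) graph with vertex set $VX$ and edge set $EX$ consisting of two-element subsets of $VX$; $X$ may be infinite, but has bounded valency (there is $M>0$ such that every vertex has at most $M$ neighbours). $\mathrm{OE}$ is the set of oriented edges (each edge gives two); for $e\in \mathrm{OE}$, $o(e)$ is the origin vertex, $t(e)$ the target vertex, $e^{-1}$ the reverse of $e$. Weight: $w:\mathrm{OE}\to(0,\infty)$ with finite total weight $\sum_{e\in \mathrm{OE}}w(e)<\infty$. For adjacent $x,x'$, $w(x,x')$ is the weight of the oriented edge from $x$ to $x'$. A path is a sequence $p=(x_0,\dots,x_n)$ of vertices with consecutive vertices adjacent; its length is $l(p)=n$ and its weight is $w(p)=w(x_0,x_1)\cdots w(x_{n-1},x_n)$. Cycles: a path of length $n\ge1$ is closed if $x_n=x_0$. It is reduced if $x_{j-1}\ne x_{j+1}$ for all $1\le j\le n-1$. A closed path has a tail if $x_1=x_{n-1}$.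 A cycle is an equivalence class of closed paths under the equivalence relation generated by $(x_0,x_1,\dots,x_n)\sim(x_1,x_2,\dots,x_n,x_1)$. A regular cycle is a cycle all of whose members are reduced and without tail. A cycle is prime if it is not a power (repetition) of a shorter one. Length and weight are well defined on cycles. $\ell^2(\mathrm{OE})$ is the Hilbert space with orthonormal basis $(e)_{e\in \mathrm{OE}}$. For a trace class operator $S$, $\det(1-S)=\sum_{k\ge0}(-1)^k\operatorname{tr}\bigwedge^kS$ is the Fredholm determinant. *)

(* Defs.v *)
From HB Require Import structures.
From Stdlib Require Import Relation_Operators.
From mathcomp Require Import all_boot all_order all_algebra finmap.
From mathcomp Require Import complex.
From mathcomp Require Import all_classical all_reals all_analysis.
From mathcomp Require Import ring.
From mathcomp.analysis.showcase Require summability.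
Export numFieldNormedType.Exports.

Set Implicit Arguments.
Unset Strict Implicit.
Unset Printing Implicit Defensive.

Import Order.TTheory GRing.Theory Num.Theory.
Import Normc.

Local Open Scope classical_set_scope.
Local Open Scope ring_scope.
Local Open Scope complex_scope.
Local Open Scope quotient_scope.

(* The usual topology of the complex numbers: [R[i]] normed over itself. *)
HB.instance Definition _ (R : rcfType) :=
  NormedModule.copy R[i] ((R[i] : numClosedFieldType)^o).

Section Analysis.
Variable R : realType.
Local Notation C := R[i].

Section Unordered.
Variable I : choiceType.

(* Convergence along the finite subsets of [I] directed by inclusion. *)
Definition sum_converges (f : I -> C) (s : C) : Prop :=
  summability.partial_sum f @ summability.totally --> s.

Definition unordered_sum (f : I -> C) : C :=
  lim (summability.partial_sum f @ summability.totally).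

Definition inner (f g : I -> C) : C := unordered_sum (fun i => f i * (g i)^*).

(* As is customary for infinite products, a limit equal to 0 does not count
   as convergence. *)
Definition prod_converges (f : I -> C) (z : C) : Prop :=
  [/\ forall i, f i != 0, z != 0 &
      (fun A : {fset I} => \prod_(i : A) f (val i)) @ summability.totally --> z].

End Unordered.

Definition entire (f : C -> C) : Prop := forall z, derivable f z 1.

(* [f] is meromorphic on the whole plane with set of poles [P]; the values of
   [f] on [P] are irrelevant.  The first clause says that [P] is closed and
   discrete. *)
Definition meromorphic (P : set C) (f : C -> C) : Prop :=
  [/\ forall z, \forall y \near z^', ~ P y,
      forall z, ~ P z -> derivable f z 1 &
      forall z, P z -> forall M : R, \forall y \near z^', M < normc (f y)].

End Analysis.

Section Ell2.
Variables (R : realType) (I : choiceType).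
Local Notation C := R[i].

Definition sqr_esum (f : I -> C) : \bar R :=
  \esum_(i in [set: I]) (normc (f i) ^+ 2)%:E.

Definition sqr_summable : {pred I -> C} := fun f => `[< (sqr_esum f < +oo)%E >].

Lemma le_sqr_esum_lin (a : C) (f g : I -> C) :
  (sqr_esum (a *: f + g)%R <=
     (2 * normc a ^+ 2)%:E * sqr_esum f + 2%:E * sqr_esum g)%E.
Proof.
have a0 : 0 <= 2 * normc a ^+ 2 by rewrite mulr_ge0// sqr_ge0.
have term (i : I) : normc ((a *: f + g) i) ^+ 2 <=
    (2 * normc a ^+ 2) * normc (f i) ^+ 2 + 2 * normc (g i) ^+ 2.
  have n0 (z : C) : 0 <= normc z by case: z => x y; rewrite sqrtr_ge0.
  have le1 : normc ((a *: f + g) i) <= normc a * normc (f i) + normc (g i).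
    by apply: le_trans (le_normcD _ _) _; rewrite normcM.
  apply: (@le_trans _ _ ((normc a * normc (f i) + normc (g i)) ^+ 2)).
    by rewrite ler_sqr ?nnegrE// ?addr_ge0 ?mulr_ge0.
  rewrite -mulrA -exprMn -subr_ge0.
  by rewrite [X in 0 <= X](_ : _ = (normc a * normc (f i) - normc (g i)) ^+ 2)
    ?sqr_ge0//; ring.
apply: ub_ereal_sup => _ [A [finA _] <-].
have leA (h : I -> C) :
    (\sum_(i \in A) (normc (h i) ^+ 2)%:E <= sqr_esum h)%E.
  by apply: ereal_sup_ubound; exists A.
apply: (@le_trans _ _ (\sum_(i \in A)
    ((2 * normc a ^+ 2)%:E * (normc (f i) ^+ 2)%:E +
     2%:E * (normc (g i) ^+ 2)%:E))%E).
  by rewrite !fsbig_finite//; apply: lee_sum => i _; rewrite -!EFinM -EFinD lee_fin.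
rewrite fsbig_split//= -!ge0_mule_fsumr; last 2 first.
- by move=> i; rewrite lee_fin sqr_ge0.
- by move=> i; rewrite lee_fin sqr_ge0.
by apply: leeD; apply: lee_wpmul2l; rewrite ?lee_fin.
Qed.

Lemma sqr_esum_ge0 (f : I -> C) : (0 <= sqr_esum f)%E.
Proof. by apply: esum_ge0 => i _; rewrite lee_fin sqr_ge0. Qed.

Lemma sqr_summable_submod : submod_closed sqr_summable.
Proof.
split=> [|a f g /asboolP f2 /asboolP g2]; apply/asboolP.
  rewrite /sqr_esum esum1// => i _.
  by rewrite (_ : normc _ = 0) ?expr0n//; exact: normc0.
apply: le_lt_trans (le_sqr_esum_lin a f g) _.
by rewrite lte_add_pinfty// lte_mul_pinfty// ?lee_fin// mulr_ge0// sqr_ge0.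
Qed.

HB.instance Definition _ :=
  GRing.isSubmodClosed.Build C (I -> C) sqr_summable sqr_summable_submod.

Record ell2 := Ell2 { ell2_fun :> I -> C; ell2P : ell2_fun \in sqr_summable }.

HB.instance Definition _ := [isSub for ell2_fun].
HB.instance Definition _ := [Choice of ell2 by <:].
HB.instance Definition _ := [SubChoice_isSubLmodule of ell2 by <:].

Definition l2norm (f : ell2) : R := Num.sqrt (fine (sqr_esum f)).

Lemma delta_subproof (i : I) :
  (fun j => (j == i)%:R : C) \in sqr_summable.
Proof.
apply/asboolP; rewrite /sqr_esum (esumID [set i])//; last first.
  by move=> j _; rewrite lee_fin sqr_ge0.
rewrite [X in (_ + X)%E]esum1 ?adde0.
  by rewrite setTI esum_set1 ?lee_fin ?sqr_ge0// ltry.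
move=> j [_ /= ji]; rewrite (_ : (j == i) = false); last by apply/eqP.
by rewrite (_ : normc _ = 0) ?expr0n//; exact: normc0.
Qed.

Definition delta (i : I) : ell2 := Ell2 (delta_subproof i).

Definition bounded_op (S : ell2 -> ell2) : Prop :=
  exists M : R, forall f, l2norm (S f) <= M * l2norm f.

(* [P] is the absolute value (S^* S)^(1/2) of [S]: it is positive and
   P^2 = S^* S, the latter being tested against all vectors. *)
Definition is_abs_op (S P : {linear ell2 -> ell2}) : Prop :=
  [/\ bounded_op P, forall f : ell2, 0 <= inner (P f) f &
      forall f g : ell2, inner (P (P f)) g = inner (S f) (S g)].

Definition trace_class (S : {linear ell2 -> ell2}) : Prop :=
  bounded_op S /\
  exists2 P : {linear ell2 -> ell2}, is_abs_op S P &
    (\esum_(i in [set: I]) (complex.Re (inner (P (delta i)) (delta i)))%:E < +oo)%E.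

(* The k-th exterior power of l^2(I) is the closed subspace of antisymmetric
   functions in l^2(I^k), in which v_1 /\ ... /\ v_k is
   (k!)^(-1/2) \sum_s sgn(s) v_(s 1) (x) ... (x) v_(s k); the sum over the
   permutations s is the Leibniz formula for the determinant below. *)
Definition wedge (k : nat) (v : 'I_k -> ell2) : k.-tuple I -> C := fun s =>
  (Num.sqrt (k`!%:R : R))%:C^-1 * \det (\matrix_(a, b) v a (tnth s b)).

(* Finite subsets of [I] with k elements, listed in some fixed order: if
   J = {i_1, ..., i_k}, the vectors d_J = d_(i_1) /\ ... /\ d_(i_k) are an
   orthonormal basis of the k-th exterior power, where d_i is [delta i]. *)
Definition ksubset (k : nat) := {J : {fset I} | #|` J| == k}.

Definition ksubset_tuple (k : nat) (J : ksubset k) : k.-tuple I := Tuple (valP J).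

(* The diagonal entry <(/\^k S) d_J, d_J>, where by definition
   (/\^k S)(v_1 /\ ... /\ v_k) = S v_1 /\ ... /\ S v_k. *)
Definition wedge_diag (S : ell2 -> ell2) (k : nat) (J : ksubset k) : C :=
  inner (wedge (fun a => S (delta (tnth (ksubset_tuple J) a))))
        (wedge (fun a => delta (tnth (ksubset_tuple J) a))).

End Ell2.

Definition is_trace_wedge (R : realType) (I : choiceType)
    (S : ell2 R I -> ell2 R I) (k : nat) (t : R[i]) : Prop :=
  sum_converges (@wedge_diag R I S k) t.

(* det (1 - S) = d *)
Definition is_fredholm_det (R : realType) (I : choiceType)
    (S : ell2 R I -> ell2 R I) (d : R[i]) : Prop :=
  exists2 t : nat -> R[i], forall k, is_trace_wedge S k (t k) &
    series (fun k => (-1) ^+ k * t k) @ \oo --> d.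

Record sgraph (V : Type) := SGraph {
  adj :> rel V;
  adj_sym : symmetric adj;
  adj_irrefl : irreflexive adj }.

Section Graph.
Variables (V : choiceType) (X : sgraph V).

Definition connected_graph : Prop :=
  forall x y, exists2 p : seq V, path X x p & last x p = y.

Definition bounded_valency : Prop :=
  exists M : nat, forall x, ([set y | X x y] #<= `I_M)%card.

Definition OE := {e : V * V | X e.1 e.2}.
HB.instance Definition _ := Choice.on OE.

Definition orig (e : OE) : V := (val e).1.
Definition targ (e : OE) : V := (val e).2.

Lemma rev_subproof (e : OE) : X (targ e, orig e).1 (targ e, orig e).2.
Proof. by rewrite /= adj_sym; exact: (valP e). Qed.

Definition rev_edge (e : OE) : OE := exist _ (targ e, orig e) (rev_subproof e).

(* The path (x_0, ..., x_n) is encoded as the list of its n + 1 vertices. *)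
Definition is_path (p : seq V) : bool := (p != [::]) && sorted X p.

Definition path_length (p : seq V) : nat := (size p).-1.

Definition is_closed (p : seq V) : bool :=
  [&& is_path p, (0 < path_length p)%N & onth p 0 == onth p (path_length p)].

Definition reduced (p : seq V) : Prop :=
  forall j, (1 <= j <= path_length p - 1)%N -> onth p j.-1 <> onth p j.+1.

Definition has_tail (p : seq V) : Prop :=
  onth p 1 = onth p (path_length p - 1).

Definition path_power (m : nat) (p : seq V) : seq V :=
  take 1 p ++ flatten (nseq m (behead p)).

Section Weight.
Variables (R : realType) (w : OE -> R).

(* the value 0 for non-adjacent vertices is never used on paths *)
Definition wt (x y : V) : R := if insub (x, y) is Some e then w e else 0.

Definition path_weight (p : seq V) : R :=
  \prod_(xy <- zip p (behead p)) wt xy.1 xy.2.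

End Weight.

Record closed_path := ClosedPath { cp_seq :> seq V; cpP : is_closed cp_seq }.
HB.instance Definition _ := [isSub for cp_seq].
HB.instance Definition _ := [Choice of closed_path by <:].

(* (x_0, x_1, ..., x_n) ~ (x_1, ..., x_n, x_1) *)
Definition shift_rel (p q : closed_path) : Prop :=
  if val p is x0 :: x1 :: s then val q = rcons (x1 :: s) x1 else False.

Definition cycle_rel : rel closed_path :=
  fun p q => `[< clos_refl_sym_trans closed_path shift_rel p q >].

Lemma cycle_rel_refl : reflexive cycle_rel.
Proof. by move=> p; apply/asboolP; exact: rst_refl. Qed.

Lemma cycle_rel_sym : symmetric cycle_rel.
Proof. by move=> p q; apply/asboolP/asboolP; exact: rst_sym. Qed.

Lemma cycle_rel_trans : transitive cycle_rel.
Proof. by move=> q p r /asboolP pq /asboolP qr; apply/asboolP; exact: rst_trans qr. Qed.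

Canonical cycle_equiv :=
  EquivRel cycle_rel cycle_rel_refl cycle_rel_sym cycle_rel_trans.

Definition gcycle := {eq_quot cycle_rel}.

Definition cycle_length (c : gcycle) : nat := path_length (repr c).

Definition cycle_weight (R : realType) (w : OE -> R) (c : gcycle) : R :=
  path_weight w (repr c).

Lemma shift_relP (p q : closed_path) : shift_rel p q ->
  exists x1 s, val p = last x1 s :: x1 :: s /\ val q = rcons (x1 :: s) x1.
Proof.
rewrite /shift_rel; case: p => -[|x0 [|x1 s]] //= pP ->; exists x1, s; split=> //.
case/and3P: pP => _ _ /= /eqP/esym/(onth_nth x1) <-.
by rewrite (last_nth x1).
Qed.

Lemma zip_rcons_shift (x y : V) (s : seq V) :
  zip (x :: rcons s y) (rcons s y) = rcons (zip (x :: s) s) (last x s, y).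
Proof. by elim: s x => [|z s IHs] x //=; rewrite IHs. Qed.

Lemma cycle_rel_length (p q : closed_path) :
  cycle_rel p q -> path_length p = path_length q.
Proof.
move=> /asboolP; elim=> {p q} [p q /shift_relP[x1 [s [pE qE]]]|//|//|].
  by rewrite /path_length -!/(val _) pE qE /= size_rcons.
by move=> p q r _ -> _ ->.
Qed.

Lemma cycle_rel_weight (R : realType) (w : OE -> R) (p q : closed_path) :
  cycle_rel p q -> path_weight w p = path_weight w q.
Proof.
move=> /asboolP; elim=> {p q} [p q /shift_relP[x1 [s [pE qE]]]|//|//|].
  rewrite /path_weight -!/(val _) pE qE /= zip_rcons_shift.
  by rewrite big_cons -cats1 big_cat big_seq1 mulrC.
by move=> p q r _ -> _ ->.
Qed.

Lemma cycle_rel_repr_pi (p : closed_path) : cycle_rel (repr (\pi_gcycle p)) p.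
Proof. by apply/eqmodP; rewrite reprK. Qed.

Lemma cycle_length_pi (p : closed_path) :
  cycle_length (\pi_gcycle p) = path_length p.
Proof. exact/cycle_rel_length/cycle_rel_repr_pi. Qed.

Lemma cycle_weight_pi (R : realType) (w : OE -> R) (p : closed_path) :
  cycle_weight w (\pi_gcycle p) = path_weight w p.
Proof. exact/cycle_rel_weight/cycle_rel_repr_pi. Qed.

Definition regular (c : gcycle) : Prop :=
  forall p : closed_path, \pi_gcycle p = c -> reduced p /\ ~ has_tail p.

Definition prime_cycle (c : gcycle) : Prop :=
  ~ exists (p q : closed_path) (m : nat),
      [/\ (1 < m)%N, \pi_gcycle p = c & val p = path_power m q].

Definition regular_primes : set gcycle := [set c | regular c /\ prime_cycle c].

Section Zeta.
Variables (R : realType) (w : OE -> R).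

Definition euler_factor (u : R[i]) (c : regular_primes) : R[i] :=
  (1 - (cycle_weight w (val c))%:C * u ^+ cycle_length (val c))^-1.

(* T e = \sum_(e') w(e') e', a finite sum when valencies are bounded *)
Definition is_edge_operator (T : {linear ell2 R OE -> ell2 R OE}) : Prop :=
  bounded_op T /\
  forall e, T (delta R e) =
    \sum_(e' \in [set e' : OE | orig e' = targ e /\ e' <> rev_edge e])
       (w e')%:C *: delta R e'.

End Zeta.

End Graph.

(* Main.v *)
(** Both sides are power series in u that satisfy Newton's identities
      n a_n = - \sum_(1 <= i <= n) p_i a_(n-i)
    with the same power sums: p_i is the total weight of the closed
    non-backtracking walks of length i with a marked starting edge.  For
    det (1 - u T) this holds for every finite compression of T (where p_i is the
    trace of the i-th power) and passes to the limit.  For the finite partial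
    products of Z(u)^-1 it holds with p_i restricted to the walks whose primitive
    root lies in the given finite set of primes, because a prime cycle of length l
    dividing i accounts for exactly l such walks.  Hence every coefficient of the
    partial products converges to that of the determinant, and the bound
    |a_n| <= W^n, with W the total weight, makes the convergence dominated.
    The determinant is entire since, by column sums, a principal minor on J is at
    most \prod_(e in J) M w(e) for valency at most M, so that the k-th coefficient
    is at most exp(rho M W) rho^-k for all rho.  Finally T^* T is block diagonal
    with finite blocks (edges with a common target), so |T| is built from square
    roots of finite positive matrices. *)

(* Working with coefficients keeps every finite stage inside polynomial identities: in
   characteristic 0 the recursion fixes a_n from a_0 = 1 and the power sums, so only the p_i have to
   be shown to converge. The truncations are indexed differently (finite sets of edges for the
   determinant, finite sets of primes for the product); they meet because both exhaust the same
   absolutely convergent sum over cyclic words. The bound W^n controls only a disc about 0, which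
   suffices for the product; entireness rests on the separate estimate of the minors. Columns are
   the right direction there: all nonzero entries in the column of e equal w(e), so the estimate is
   a product over J, and the sum over all J is a product of factors 1 + rho M w(e), whence the
   exponential. Meromorphy of Z also requires that the zeros of the determinant be isolated; the
   source of this is that the difference quotient of a power series is again a power series with
   controlled coefficients. *)
From HB Require Import structures.
From Stdlib Require Import Relation_Operators.
Require Import Defs.
From mathcomp Require Import all_boot all_order all_algebra finmap perm.
From mathcomp Require Import spectral sesquilinear complex.
From mathcomp Require Import all_classical all_reals all_analysis.
From mathcomp Require Import zify ring lra.
From mathcomp.analysis.showcase Require summability.

Set Implicit Arguments.
Unset Strict Implicit.
Unset Printing Implicit Defensive.

Import Order.TTheory GRing.Theory Num.Theory.
Import Normc.

(** * Powers and periods of words *)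

Section Words.
Variable T : eqType.
Implicit Types (s t b : seq T).

Definition pow m b := flatten (nseq m b).

Lemma powS m b : pow m.+1 b = b ++ pow m b. Proof. by []. Qed.

Lemma size_pow m b : size (pow m b) = (m * size b)%N.
Proof. by elim: m => [|m IH] //; rewrite powS size_cat IH mulSn. Qed.

Lemma powSr m b : pow m.+1 b = pow m b ++ b.
Proof. by elim: m => [|m IH]; [rewrite /pow /= cats0|rewrite powS {1}IH catA -powS]. Qed.

Lemma powD m n b : pow (m + n) b = pow m b ++ pow n b.
Proof. by elim: m => [|m IH] //; rewrite addSn !powS -catA IH. Qed.

Lemma pow_mul m n b : pow m (pow n b) = pow (m * n) b.
Proof.
by elim: m => [|m IH] //; rewrite powS IH mulSn powD.
Qed.

Lemma rot_pow m b : rot (size b) (pow m b) = pow m b.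
Proof. by case: m => [|m]; [exact: rot_oversize|rewrite {1}powS rot_size_cat powSr]. Qed.

Lemma cat_pow m b c : b ++ pow m (c ++ b) = pow m (b ++ c) ++ b.
Proof. by elim: m => [|m IH]; [rewrite cats0|rewrite !powS -!catA IH]. Qed.

Lemma rot_powE k m b : (k <= size b)%N -> rot k (pow m b) = pow m (rot k b).
Proof.
move=> kb; rewrite -(cat_take_drop k b); move: (size_takel kb).
move: (take k b) (drop k b) => x y <-; case: m => // m.
by rewrite rot_size_cat !powS -!catA rot_size_cat -catA -cat_pow.
Qed.

Lemma iter_rot k s : (k <= size s)%N -> iter k (rot 1) s = rot k s.
Proof.
elim: k => [|k IH] ks; first by rewrite rot0.
by rewrite iterS IH 1?ltnW// -rotS.
Qed.

Lemma iter_rot_inj k : injective (iter k (@rot T 1)).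
Proof. by elim: k => //= k IH s t /rot_inj/IH. Qed.

(** Commutation makes [b] a prefix of [r]; cancelling it leaves a shorter word that still commutes
    with [b], and the length condition lets the descent end at the empty word. *)
Lemma pow_of_comm b r j : size r = (j * size b)%N -> r ++ b = b ++ r -> r = pow j b.
Proof.
elim: j r => [|j IH] r sr rb; first by apply/size0nil; rewrite sr.
have br : take (size b) r = b.
  have : take (size b) (r ++ b) = b by rewrite rb take_size_cat.
  by rewrite takel_cat// sr mulSn leq_addr.
move: rb; rewrite -(cat_take_drop (size b) r) br -catA => /eqP.
rewrite eqseq_cat// eqxx /= => /eqP/IH ->//.
by rewrite size_drop sr mulSn addKn.
Qed.

(** Splitting [t] after [l] letters as [x ++ y], invariance under the rotation says that
    [y ++ x = x ++ y]. *)
Lemma rot_fixed_pow l t : (0 < l)%N -> (l %| size t)%N -> rot l t = t ->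
  t = pow (size t %/ l) (take l t).
Proof.
move=> l0 /dvdnP[[|j] st] rt; first by have /size0nil-> : size t = 0 by []; rewrite /= div0n.
have lt : (l <= size t)%N by rewrite st mulSn leq_addr.
have sl : size (take l t) = l by rewrite size_takel.
rewrite st mulnK// powS -{1}(cat_take_drop l t); congr (_ ++ _).
apply: pow_of_comm; first by rewrite size_drop sl st mulSn addKn.
by rewrite cat_take_drop.
Qed.

Lemma period_exists t : exists d, (0 < d)%N && (iter d (rot 1) t == t).
Proof.
case: (posnP (size t)) => [/size0nil->|t0]; first by exists 1%N.
by exists (size t); rewrite t0 iter_rot// rot_size/=.
Qed.

(** Iterates of [rot 1] compose additively, whereas [rot d] is the identity once [d] exceeds the
    length. *)
Definition period t := ex_minn (period_exists t).

Lemma period_gt0 t : (0 < period t)%N.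
Proof. by rewrite /period; case: ex_minnP => d /andP[]. Qed.

Lemma iter_period t : iter (period t) (rot 1) t = t.
Proof. by rewrite /period; case: ex_minnP => d /andP[_ /eqP]. Qed.

Lemma period_min t d : (0 < d)%N -> iter d (rot 1) t = t -> (period t <= d)%N.
Proof.
move=> d0 dt; rewrite /period; case: ex_minnP => m _; apply.
by rewrite d0 dt eqxx.
Qed.

Lemma iter_rot_fixed t k : (iter k (rot 1) t == t) = (period t %| k)%N.
Proof.
have it q : iter (q * period t) (rot 1) t = t.
  by elim: q => // q IH; rewrite mulSn addnC iterD iter_period.
apply/idP/idP => [h|/dvdnP[q ->]]; last by rewrite it.
rewrite /dvdn; case: posnP => // r0.
have /eqP : iter (k %% period t) (rot 1) t == t.
  by move: h; rewrite {1}(divn_eq k (period t)) addnC iterD it.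
move=> /(period_min r0).
by rewrite leqNgt ltn_pmod// period_gt0.
Qed.

Lemma period_dvd_size t : t != [::] -> (period t %| size t)%N.
Proof. by move=> _; rewrite -iter_rot_fixed iter_rot// rot_size. Qed.

(** The empty word has period 1 and length 0, so primitive words are nonempty. *)
Definition primitive t := period t == size t.

Lemma period_le_size t : t != [::] -> (period t <= size t)%N.
Proof. by move=> t0; rewrite dvdn_leq ?period_dvd_size// lt0n size_eq0. Qed.

Lemma rot_period t : t != [::] -> rot (period t) t = t.
Proof. by move=> t0; rewrite -iter_rot ?iter_period ?period_le_size. Qed.

Lemma period_pow m b : b != [::] -> (0 < m)%N -> (period (pow m b) %| size b)%N.
Proof.
move=> b0 m0; rewrite -iter_rot_fixed iter_rot ?rot_pow//.
by rewrite size_pow leq_pmull.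
Qed.

(** Links the rotation period to the definition of primality by repetitions: a period shorter than
    the word exhibits it as a proper power of its prefix of that length. *)
Lemma primitive_pow b : primitive b <-> b != [::] /\
  forall m c, (1 < m)%N -> b != pow m c.
Proof.
split=> [/eqP pb|[b0 h]].
  have b0 : b != [::] by rewrite -size_eq0 -lt0n -pb period_gt0.
  split=> // m c m1; apply/eqP => bE.
  have c0 : c != [::] by apply: contraNneq b0 => c0; rewrite bE c0 -size_eq0 size_pow muln0.
  have := period_pow c0 (ltnW m1); rewrite -bE pb bE size_pow.
  have : (0 < size c)%N by rewrite lt0n size_eq0.
  by move=> c1 /(dvdn_leq c1); nia.
rewrite /primitive; apply/negPn/negP => pb.
have : ~~ (1 < size b %/ period b)%N.
  apply/negP => q1; have := h _ (take (period b) b) q1.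
  by rewrite -rot_fixed_pow ?period_gt0 ?period_dvd_size ?rot_period// eqxx.
rewrite -leqNgt => le1.
have p0 := period_gt0 b; have := period_dvd_size b0.
move=> /dvdnP[q qE]; move: le1 pb b0; rewrite -size_eq0 qE mulnK//.
by case: q {qE} => [|[|q]] //; rewrite ?mul0n// mul1n eqxx.
Qed.

(** If the root were a proper power of [c], then [t] would be a power of [c] too, and its period
    would divide the size of [c], which is smaller than the period. *)
Lemma primitive_root t : t != [::] -> primitive (take (period t) t).
Proof.
move=> t0; have le := period_le_size t0; have p0 := period_gt0 t.
have st : size (take (period t) t) = period t by rewrite size_takel.
apply/primitive_pow; split=> [|m c m1]; first by rewrite -size_eq0 st -lt0n.
apply/eqP => E; have := rot_fixed_pow p0 (period_dvd_size t0) (rot_period t0).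
rewrite E pow_mul => tE.
have c0 : c != [::].
  by apply: contraTneq p0 => c0; rewrite -st E c0 size_pow muln0.
have q0 : (0 < size t %/ period t * m)%N.
  by rewrite muln_gt0 divn_gt0// le ltnW.
have c1 : (0 < size c)%N by rewrite lt0n size_eq0.
have := period_pow c0 q0; rewrite -tE => /(dvdn_leq c1).
have := congr1 size E; rewrite st size_pow => ->; nia.
Qed.

Lemma period_rot k t : (k <= size t)%N -> period (rot k t) = period t.
Proof.
move=> kt; have E d : (iter d (rot 1) (rot k t) == rot k t) = (iter d (rot 1) t == t).
  rewrite -(iter_rot kt) -iterD addnC iterD.
  by apply/eqP/eqP => [/iter_rot_inj|->].
apply/eqP; rewrite eqn_dvd -iter_rot_fixed E iter_period eqxx /=.
by rewrite -iter_rot_fixed -E iter_period.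
Qed.

Lemma primitive_rot k t : (k <= size t)%N -> primitive (rot k t) = primitive t.
Proof. by move=> kt; rewrite /primitive period_rot// size_rot. Qed.

(** A rotation by at most one block that fixes the power also fixes the block, so its amount is a
    multiple of the period of the block. *)
Lemma period_pow_primitive m b : primitive b -> (0 < m)%N -> period (pow m b) = size b.
Proof.
move=> /eqP pb m0; have b1 : (0 < size b)%N by rewrite -pb period_gt0.
have b0 : b != [::] by rewrite -size_eq0 -lt0n.
have dv := period_pow b0 m0; set d := period _ in dv *.
have t0 : pow m b != [::] by rewrite -size_eq0 size_pow -lt0n muln_gt0 m0.
apply/eqP; rewrite eqn_dvd dv -[X in (X %| _)%N]pb -iter_rot_fixed.
have db : (d <= size b)%N by rewrite dvdn_leq.
rewrite iter_rot//; have := iter_period (pow m b).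
rewrite -/d iter_rot; last by rewrite size_pow (leq_trans db)// leq_pmull.
rewrite rot_powE//; case: m m0 @d {dv t0} db => // m _ d db.
by rewrite !powS => /eqP; rewrite eqseq_cat ?size_rot// => /andP[].
Qed.

Lemma pow_primitive_inj m m' b b' : primitive b -> primitive b' ->
  (0 < m)%N -> (0 < m')%N -> pow m b = pow m' b' -> b = b'.
Proof.
move=> pb pb' m0 m0' E.
have sb : size b = size b' by rewrite -(period_pow_primitive pb m0) E period_pow_primitive.
case: m m' m0 m0' E => [|m] [|m'] // _ _; rewrite !powS => /eqP.
by rewrite eqseq_cat// => /andP[/eqP].
Qed.

Lemma rot_primitive_inj k k' b : primitive b -> (k < size b)%N -> (k' < size b)%N ->
  rot k b = rot k' b -> k = k'.
Proof.
wlog: k k' / (k <= k')%N => [H|kk'] pb kb kb' E.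
  by case: (leqP k k') => [|/ltnW] le; [apply: H|apply/esym/H].
move: E; rewrite -!iter_rot ?(ltnW kb) ?(ltnW kb')// -(subnKC kk') iterD.
move=> /iter_rot_inj/esym/eqP; rewrite iter_rot_fixed (eqP pb) => /dvdnP[[|q] E].
  by rewrite E addn0.
by move: (leq_subr k k') (kb'); rewrite E; lia.
Qed.

Lemma path_last_pow (e : rel T) x m b : last x b = x -> path e x b -> path e x (pow m b).
Proof.
move=> lb pb; suff [] : path e x (pow m b) /\ last x (pow m b) = x by [].
elim: m => [|m [IH1 IH2]] //; rewrite powS cat_path last_cat lb pb.
by split; [exact: IH1|exact: IH2].
Qed.

Lemma last_pow x m b : b != [::] -> last x (pow m.+1 b) = last x b.
Proof. by rewrite powSr last_cat; case: b. Qed.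

Lemma cycle_pow (e : rel T) m b : b != [::] -> (0 < m)%N ->
  cycle e (pow m b) = cycle e b.
Proof.
case: b m => // x b [|m] // _ _; rewrite !(cycle_path x) last_pow//.
apply/idP/idP; first by rewrite powS cat_path => /andP[].
exact: path_last_pow.
Qed.

Lemma divn_size_gt0 t (i : nat) : (0 < i)%N -> t != [::] ->
  (size t %| i)%N -> (0 < i %/ size t)%N.
Proof.
move=> i0 t0 ti; have st : (0 < size t)%N by rewrite lt0n size_eq0.
by rewrite divn_gt0//; exact: dvdn_leq.
Qed.

Fixpoint words (s : seq T) (i : nat) : seq (seq T) :=
  if i is j.+1 then [seq x :: t | x <- s, t <- words s j] else [:: [::]].

Lemma mem_words s i t : (t \in words s i) = (size t == i) && all (mem s) t.
Proof.
elim: i t => [|i IH] [|x t] //=; first by apply/allpairsP => -[[? ?] []].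
rewrite eqSS; apply/allpairsP/idP => [[[y u] /= [ys +  [-> ->]]]|].
  by rewrite IH ys.
by case/and3P=> st xs ts; exists (x, t); split=> //; rewrite IH st.
Qed.

Lemma words_uniq s i : uniq s -> uniq (words s i).
Proof.
move=> us; elim: i => //= i IH; apply: allpairs_uniq => //.
by move=> [x t] [y u] _ _ /= [-> ->].
Qed.

End Words.

Local Open Scope ring_scope.

(** * Newton's identities and principal minors *)

Section Newton.
Variable K : fieldType.
Implicit Types (Q P : {poly K}) (p : nat -> K).

(* The identity  - X Q' = (\sum_(i > 0) p i X^i) Q  modulo X^(N+1). *)
Definition newton (N : nat) Q p : Prop := forall n, (n <= N)%N ->
  ('X * Q^`() + (\poly_(i < N.+1) (p i *+ (0 < i)%N)) * Q)`_n = 0.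

Lemma coefM_eq0 N (A B : {poly K}) : (forall n, (n <= N)%N -> A`_n = 0) ->
  forall n, (n <= N)%N -> (A * B)`_n = 0.
Proof.
move=> A0 n nN; rewrite coefM big1// => i _; rewrite A0 ?mul0r//.
by apply: leq_trans nN; rewrite -ltnS.
Qed.

Lemma newton1 N : newton N 1 (fun=> 0).
Proof.
move=> n nN; rewrite derivC mulr0 add0r mulr1 coef_poly.
by rewrite ltnS nN mul0rn.
Qed.

Lemma eq_newton N Q p p' : newton N Q p -> p =1 p' -> newton N Q p'.
Proof.
by move=> h /funext <-.
Qed.

(** Logarithmic derivatives add: by the product rule the expression for [Q1 * Q2] is that for [Q1]
    times [Q2] plus that for [Q2] times [Q1], and vanishing up to degree [N] survives
    multiplication. *)
Lemma newtonM N Q1 Q2 p1 p2 : newton N Q1 p1 -> newton N Q2 p2 ->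
  newton N (Q1 * Q2) (fun i => p1 i + p2 i).
Proof.
rewrite /newton => h1 h2 n nN.
have -> : \poly_(i < N.+1) ((p1 i + p2 i) *+ (0 < i)%N) =
    \poly_(i < N.+1) (p1 i *+ (0 < i)%N) + \poly_(i < N.+1) (p2 i *+ (0 < i)%N).
  by apply/polyP => i; rewrite coefD !coef_poly; case: ifP => _; rewrite ?addr0// mulrnDl.
rewrite derivM.
set A := 'X * Q1^`() + _ in h1; set B := 'X * Q2^`() + _ in h2.
rewrite (_ : _ + _ = A * Q2 + B * Q1); last by rewrite /A /B; ring.
by rewrite coefD !(coefM_eq0 _ (N := N)) ?addr0.
Qed.

Lemma newton_prod N (I : Type) (r : seq I) (Q : I -> {poly K}) (p : I -> nat -> K) :
  (forall i, newton N (Q i) (p i)) ->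
  newton N (\prod_(i <- r) Q i) (fun n => \sum_(i <- r) p i n).
Proof.
move=> h; elim: r => [|i r IHr].
  by rewrite big_nil; apply: eq_newton (@newton1 N) _ => n; rewrite big_nil.
by rewrite big_cons; apply: eq_newton (newtonM (h i) IHr) _ => n; rewrite big_cons.
Qed.

(** For [Q = 1 - a X^l] the series [- X Q' / Q] is [l a X^l / (1 - a X^l)], the sum of
    [l a^j X^(l j)] over [j >= 1]. *)
Lemma newton_1subXn N (a : K) (l : nat) : (0 < l)%N ->
  newton N (1 - a *: 'X^l) (fun i => (l%:R * a ^+ (i %/ l)) *+ (l %| i)%N).
Proof.
move=> l0 n nN; set P := \poly_(i < _) _.
have PE i : (i <= N)%N -> P`_i = (l%:R * a ^+ (i %/ l)) *+ ((l %| i) && (0 < i))%N.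
  by move=> iN; rewrite coef_poly ltnS iN -mulrnA mulnb.
rewrite mulrBr mulr1 coefD coefB -scalerAr coefZ coefMXn.
rewrite derivB derivC sub0r derivZ derivXn mulrN coefN -scalerAr coefZ.
rewrite mulrnAr coefMn -exprS prednK// coefXn.
case: (ltngtP n l) => [nl|ln|nl].
- rewrite mul0rn !mulr0 oppr0 addr0 add0r PE//.
  case: (posnP n) => [->|n0]; first by rewrite andbF.
  by rewrite gtnNdvd.
- have lN : (n - l <= N)%N by rewrite (leq_trans (leq_subr _ _)).
  rewrite mul0rn mulr0 oppr0 add0r !PE// subn_gt0 ln dvdn_subl ?dvdnn ?(ltnW ln)//.
  rewrite (leq_ltn_trans _ ln)// !andbT; case: (boolP (l %| n)%N) => [ldn|_]; last by rewrite mulr0 subr0.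
  have -> : (n %/ l = ((n - l) %/ l).+1)%N.
    by rewrite -{1}(subnK (ltnW ln)) divnDr ?dvdnn// divnn l0 addn1.
  by rewrite exprS mulr1n mulrCA subrr.
- subst n; rewrite subnn !PE// ltnn andbF dvdnn l0 divnn l0 expr1.
  by rewrite /= !mulr0n mulr0 subr0 !mulr1n mulr_natr mulr_natl addNr.
Qed.

Lemma newtonP N Q p n : newton N Q p -> (n <= N)%N ->
  Q`_n *+ n = - \sum_(i < n) p i.+1 * Q`_(n - i.+1).
Proof.
move=> h nN; have /eqP := h n nN; rewrite coefD addr_eq0 => /eqP E.
have -> : Q`_n *+ n = ('X * Q^`())`_n.
  by rewrite coefXM; case: n nN {h E} => [|n] _ //=; rewrite coef_deriv.
rewrite E; congr (- _).
rewrite coefM big_ord_recl coef_poly /= mulr0n mul0r add0r.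
apply: eq_bigr => i _; rewrite coef_poly /bump /= add1n ltnS.
by rewrite (leq_trans (ltn_ord i) nN) mulr1n.
Qed.

End Newton.

Section PrincipalMinors.
Variable K : comNzRingType.

(* The rows outside J are replaced by rows of the identity: the determinant is
   the principal minor on J, while the size of the matrix stays n. *)
Definition pminor n (A : 'M[K]_n) (J : {set 'I_n}) : K :=
  \det (\matrix_(i, j) if i \in J then A i j else (i == j)%:R).

(** In the Leibniz formula a permutation [s] contributes a product of binomials
    [(i == s i) + x * A i (s i)]; [J] records the rows in which the second term is chosen. *)
Lemma det_1addMx n (A : 'M[K]_n) (x : K) :
  \det (1%:M + x *: A) = \sum_(J : {set 'I_n}) x ^+ #|J| * pminor A J.
Proof.
rewrite {1}/determinant.
transitivity (\sum_(s : 'S_n) \sum_(J : {set 'I_n}) (-1) ^+ s *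
    \prod_i (if i \in J then x * A i (s i) else (i == s i)%:R)).
  apply: eq_bigr => s _; rewrite -big_distrr /=; congr (_ * _).
  rewrite -(bigA_distr _ _ (fun i => x * A i (s i)) (fun i => (i == s i)%:R)).
  by apply: eq_bigr => i _; rewrite !mxE addrC.
rewrite exchange_big /=; apply: eq_bigr => J _; rewrite /pminor /determinant mulr_sumr.
apply: eq_bigr => s _; rewrite [RHS]mulrCA; congr (_ * _).
rewrite -prodr_const [X in _ = X * _]big_mkcond /= -big_split /=; apply: eq_bigr => i _.
by rewrite !mxE; case: ifP; rewrite ?mul1r.
Qed.

(** Sylvester's identity: the two block triangular matrices are products of the same two factors in
    opposite orders. *)
Lemma det_1addM_comm m n (A : 'M[K]_(m, n)) (B : 'M[K]_(n, m)) :
  \det (1%:M + A *m B) = \det (1%:M + B *m A).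
Proof.
have h1 : block_mx (1%:M + A *m B) A 0 1%:M =
  block_mx 1%:M A (- B) 1%:M *m block_mx 1%:M 0 B 1%:M.
  by rewrite mulmx_block !mul1mx !mulmx1 !mulmx0 add0r addNr add0r.
have h2 : block_mx 1%:M A 0 (1%:M + B *m A) =
  block_mx 1%:M 0 B 1%:M *m block_mx 1%:M A (- B) 1%:M.
  by rewrite mulmx_block !mul1mx !mulmx1 !mul0mx !addr0 subrr addrC.
have := congr1 determinant h1; have := congr1 determinant h2.
by rewrite !det_mulmx !det_ublock !det_lblock !det1 !mul1r !mulr1 => -> ->.
Qed.

Lemma pminor_enum k n (A : 'M[K]_n) (f : 'I_k -> 'I_n) : injective f ->
  pminor A [set f a | a : 'I_k] = \det (\matrix_(a, b) A (f a) (f b)).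
Proof.
move=> fI; pose S : 'M[K]_(n, k) := \matrix_(i, a) (i == f a)%:R.
have rowS p (B : 'M[K]_(n, p)) : S^T *m B = \matrix_(a, j) B (f a) j.
  apply/matrixP => a j; rewrite !mxE (bigD1 (f a))//= !mxE eqxx mul1r.
  by rewrite big1 ?addr0// => i /negPf ia; rewrite !mxE ia mul0r.
have STS : S^T *m S = 1%:M.
  by rewrite rowS; apply/matrixP => a b; rewrite !mxE (inj_eq fI).
(* The padded matrix is [1 + S S^T (A - 1)]; exchanging the factors turns it into
   [1 + S^T (A - 1) S = S^T A S], the small matrix. *)
have -> : pminor A [set f a | a : 'I_k] = \det (1%:M + S *m (S^T *m (A - 1%:M))).
  rewrite /pminor rowS; congr (\det _); apply/matrixP => i j; rewrite !mxE.
  case: imsetP => [[a _ ->]|ni].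
    rewrite (bigD1 a)//= !mxE eqxx mul1r big1 ?addr0; last first.
      by move=> b /negPf ba; rewrite !mxE (inj_eq fI) eq_sym ba mul0r.
    by rewrite addrC subrK.
  rewrite big1 ?addr0// => a _; rewrite !mxE.
  by case: eqP => [ia|]; [case: ni; exists a|rewrite mul0r].
rewrite det_1addM_comm mulmxBr mulmx1 mulmxBl STS addrC subrK -mulmxA rowS.
congr (\det _); apply/matrixP => a b; rewrite !mxE (bigD1 (f b))//= !mxE eqxx mulr1.
by rewrite big1 ?addr0// => i /negPf ia; rewrite !mxE ia mulr0.
Qed.

End PrincipalMinors.

(** * Characteristic series of a finite matrix *)

Section CharSeries.
Variable C : numClosedFieldType.

Lemma trig_mulmx n (A B : 'M[C]_n) : is_trig_mx A -> is_trig_mx B ->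
  is_trig_mx (A *m B) /\ forall i, (A *m B) i i = A i i * B i i.
Proof.
move=> /is_trig_mxP tA /is_trig_mxP tB; split.
  apply/is_trig_mxP => i j ij; rewrite mxE big1// => k _.
  have [ik|ki] := ltnP i k; first by rewrite tA ?mul0r.
  by rewrite tB ?mulr0// (leq_ltn_trans ki).
move=> i; rewrite mxE (bigD1 i)//= big1 ?addr0// => k.
rewrite neq_ltn => /orP[ki|ik]; first by rewrite tB ?mulr0.
by rewrite tA ?mul0r.
Qed.

(** The reversed characteristic polynomial, whose factors are 1 minus an eigenvalue times X. *)
Definition charseries n (A : 'M[C]_n) : {poly C} :=
  \det (1%:M - 'X *: map_mx polyC A).

(** Schur triangularization turns the determinant into a product of linear factors [1 - U j j X] and
    the traces of powers into power sums of the same diagonal entries. Size 0 is separate because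
    the triangularization asks for a positive size. *)
Lemma newton_charseries N n (A : 'M[C]_n) :
  newton N (charseries A) (fun i => \tr (A ^+ i)).
Proof.
case: n A => [|n] A.
  rewrite /charseries det_mx00; apply: eq_newton (@newton1 C N) _ => i.
  by rewrite /mxtrace big_ord0.
have [P Pu tP] := Schur A (ltn0Sn n).
have uP := unitarymx_unit Pu.
have {tP} [U [tP UE]] : exists U, is_trig_mx U /\ U = P *m A *m invmx P.
  by exists (conjmx P A); split=> //; rewrite conjumx.
have AE : A = invmx P *m U *m P by rewrite UE !mulmxA mulVmx// mul1mx mulmxKV.
have powU i : is_trig_mx (U ^+ i) /\ forall j, (U ^+ i) j j = U j j ^+ i.
  elim: i => [|i [t d]].
    rewrite !expr0; split=> [|j]; first exact: scalar_mx_is_trig.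
    by rewrite expr0 mxE eqxx.
  have [t' d'] := trig_mulmx tP t; rewrite exprS; split=> // j.
  by rewrite [LHS]d' d exprS.
have powA i : A ^+ i = invmx P *m U ^+ i *m P.
  elim: i => [|i IH]; first by rewrite !expr0 mulmx1 mulVmx.
  by rewrite !exprS IH {1}AE -!mulmxE !mulmxA mulmxK.
have trA i : \tr (A ^+ i) = \sum_j U j j ^+ i.
  rewrite powA mxtrace_mulC mulmxA mulmxV// mul1mx.
  by apply: eq_bigr => j _; have [_ ->] := powU i.
have detA : charseries A = \prod_j (1 - (U j j) *: 'X^1).
  pose Pp := map_mx polyC P; pose Vp := map_mx polyC (invmx P).
  have VP : Vp *m Pp = 1%:M by rewrite -map_mxM mulVmx// map_mx1.
  rewrite /charseries (_ : _ - _ = Vp *m (1%:M - 'X *: map_mx polyC U) *m Pp); last first.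
    rewrite mulmxBr mulmx1 mulmxBl VP; congr (_ - _).
    by rewrite {1}AE !map_mxM -scalemxAr -scalemxAl.
  rewrite !det_mulmx mulrAC -det_mulmx VP det1 mul1r det_trig.
    by apply: eq_bigr => j _; rewrite !mxE eqxx mulr1n expr1 mulrC mul_polyC.
  apply/is_trig_mxP => i j ij; rewrite !mxE (is_trig_mxP tP : forall i j, _ -> U i j = 0)// polyC0 mulr0 subr0.
  by rewrite -val_eqE ltn_eqF.
have := newton_prod (index_enum _) (fun j => @newton_1subXn _ N (U j j) _ (ltn0Sn 0)).
rewrite -detA => H; apply: eq_newton H _ => i.
by rewrite trA; apply: eq_bigr => j _; rewrite dvd1n divn1 mul1r.
Qed.

Lemma coef_charseries n (A : 'M[C]_n) k :
  (charseries A)`_k = (-1) ^+ k * \sum_(J : {set 'I_n} | #|J| == k) pminor A J.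
Proof.
rewrite /charseries -scaleNr det_1addMx coef_sum mulr_sumr [RHS]big_mkcond /=.
apply: eq_bigr => J _.
have -> : pminor (map_mx polyC A) J = (pminor A J)%:P.
  rewrite /pminor -det_map_mx; congr (\det _); apply/matrixP => i j.
  by rewrite !mxE; case: ifP => _ //=; rewrite rmorph_nat.
have -> : (- 'X : {poly C}) ^+ #|J| = (-1) ^+ #|J| *: 'X^#|J|.
  by rewrite -scaleN1r exprZn.
rewrite coefMC coefZ coefXn eq_sym; case: eqP => [->|_]; last by rewrite mulr0 mul0r.
by rewrite mulr1.
Qed.

End CharSeries.

(** * Square roots of positive matrices *)

Section MatrixSqrt.
Local Open Scope sesquilinear_scope.
Variable C : numClosedFieldType.

Lemma adj_mulmx m n p (A : 'M[C]_(m, n)) (B : 'M[C]_(n, p)) :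
  (A *m B)^t* = B^t* *m A^t*.
Proof. by rewrite trmx_mul map_mxM. Qed.

Lemma mulmx_adj_ge0 m n (A : 'M[C]_(m, n)) i : 0 <= (A *m A^t*) i i.
Proof. by rewrite mxE sumr_ge0// => j _; rewrite !mxE mul_conjC_ge0. Qed.

Lemma exists_sqrt_mx m n (B : 'M[C]_(n, m)) : exists P : 'M[C]_n,
  [/\ P^t* = P, P *m P = B *m B^t* &
      forall x : 'rV[C]_n, 0 <= (x *m P *m x^t*) 0 0].
Proof.
pose A := B *m B^t*.
have Aadj : A^t* = A by rewrite /A adj_mulmx trmxCK.
have An : A \is normalmx by apply/normalmxP; rewrite Aadj.
have AE := orthomx_spectralP An.
set U := spectralmx A in AE *; set D := spectral_diag A in AE.
have Uu : U \is unitarymx := spectral_unitarymx A.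
rewrite invmx_unitary// in AE.
have UU : U *m U^t* = 1%:M by apply/unitarymxP.
(* The eigenvalues are diagonal entries of [(U B) (U B)^*]. *)
have D0 i : 0 <= D 0 i.
  have -> : D 0 i = ((U *m B) *m (U *m B)^t*) i i.
    rewrite adj_mulmx mulmxA -[U *m B *m _]mulmxA -/A AE !mulmxA UU mul1mx.
    by rewrite -mulmxA UU mulmx1 mxE eqxx mulr1n.
  exact: mulmx_adj_ge0.
pose Q := diag_mx (\row_i sqrtC (D 0 i)).
have Qadj : Q^t* = Q.
  rewrite /Q tr_diag_mx map_diag_mx; congr diag_mx; apply/rowP => i.
  by rewrite !mxE; apply/CrealP/ger0_real; rewrite sqrtC_ge0.
have QQ : Q *m Q = diag_mx D.
  rewrite mulmx_diag; congr diag_mx; apply/rowP => i.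
  by rewrite !mxE -expr2 sqrtCK.
exists (U^t* *m Q *m U); split.
- by rewrite !adj_mulmx trmxCK Qadj mulmxA.
- rewrite !mulmxA -[U^t* *m Q *m U *m _]mulmxA UU mulmx1 -[_ *m Q *m Q]mulmxA QQ.
  by rewrite -AE.
move=> x; pose y := x *m U^t*.
have -> : x *m (U^t* *m Q *m U) *m x^t* = y *m Q *m y^t*.
  by rewrite /y adj_mulmx trmxCK !mulmxA.
rewrite mxE sumr_ge0// => i _; rewrite mul_mx_diag !mxE mulrAC.
by rewrite mulr_ge0 ?mul_conjC_ge0// sqrtC_ge0.
Qed.

End MatrixSqrt.

Local Open Scope classical_set_scope.
Local Open Scope complex_scope.
Local Open Scope quotient_scope.

(** * Unordered sums of complex numbers *)

Local Notation totally := summability.totally.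
#[local] Existing Instance summability.totally_filter.

Section NormC.
Variable R : rcfType.
Implicit Types x y : R[i].

Lemma normc_ge0 x : 0 <= normc x.
Proof. by case: x => a b; rewrite sqrtr_ge0. Qed.

Lemma normcR (a : R) : normc a%:C = `|a|.
Proof. by rewrite /normc /= expr0n addr0 sqrtr_sqr. Qed.

Lemma normcX x n : normc (x ^+ n) = normc x ^+ n.
Proof. by elim: n => [|n IH]; rewrite ?normc1// !exprS normcM IH. Qed.

Lemma normc_eq0 x : (normc x == 0) = (x == 0).
Proof. by apply/eqP/eqP => [/eq0_normc//|->]; rewrite normc0. Qed.

Lemma normc_gt0 x : (0 < normc x) = (x != 0).
Proof. by rewrite lt_def normc_eq0 normc_ge0 andbT. Qed.

Lemma normcB x y : normc (x - y) = normc (y - x).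
Proof. by rewrite -normcN opprB. Qed.

Lemma normc_sum (I : Type) (r : seq I) (P : pred I) (F : I -> R[i]) :
  normc (\sum_(i <- r | P i) F i) <= \sum_(i <- r | P i) normc (F i).
Proof.
elim/big_ind2: _ => [|x a y b xa yb|//]; first by rewrite normc0.
by apply: le_trans (le_normcD _ _) _; exact: lerD.
Qed.

Lemma normc_prod (I : Type) (r : seq I) (P : pred I) (F : I -> R[i]) :
  normc (\prod_(i <- r | P i) F i) = \prod_(i <- r | P i) normc (F i).
Proof. by elim/big_ind2: _ => [|x a y b <- <-|//]; rewrite ?normc1 ?normcM. Qed.

Lemma normc_lt_eq0 x : (forall e : R, 0 < e -> normc x < e) -> x = 0.
Proof.
move=> h; apply/eqP; rewrite -normc_eq0; apply/negPn/negP => x0.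
have xp : 0 < normc x by rewrite lt_def x0 normc_ge0.
by have := h _ xp; rewrite ltxx.
Qed.

Lemma normE x : `|x| = (normc x)%:C.
Proof. by []. Qed.

Lemma le_normc_Re x : `|complex.Re x| <= normc x.
Proof. by case: x => a b /=; rewrite -sqrtr_sqr ler_wsqrtr// lerDl sqr_ge0. Qed.

Lemma le_normc_Im x : `|complex.Im x| <= normc x.
Proof. by case: x => a b /=; rewrite -sqrtr_sqr ler_wsqrtr// lerDr sqr_ge0. Qed.

Lemma normc_conj x : normc (conjc x) = normc x.
Proof. by case: x => a b /=; rewrite sqrrN. Qed.

Lemma mulc_conj x : x * conjc x = (normc x ^+ 2)%:C.
Proof. by rewrite -sqr_normc normE rmorphXn. Qed.

End NormC.

Section Limits.
Variables (R : realType).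
Local Notation C := R[i].

(** The norm of [R[i]] takes values in [R[i]]; real [e] suffice because a positive complex number
    has imaginary part 0. *)
Lemma cvg_normcP T (F : set_system T) {FF : Filter F} (f : T -> C) (l : C) :
  f @ F --> l <-> forall e : R, 0 < e -> \forall t \near F, normc (f t - l) < e.
Proof.
split=> [/cvgrPdist_lt h e e0|h].
  have e0' : 0 < e%:C :> C by rewrite ltcR.
  apply: filterS (h _ e0') => t /=.
  by rewrite normE ltcR normcB.
apply/cvgrPdist_lt => e; rewrite ltcE /= => /andP[/eqP ei er].
apply: filterS (h _ er) => t /=.
by rewrite normE [e](_ : _ = (complex.Re e)%:C) ?ltcR 1?normcB//; case: e ei {er} => a b /= ->.
Qed.

Lemma cvgCD T (F : set_system T) {FF : Filter F} (f g : T -> C) (a b : C) :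
  f @ F --> a -> g @ F --> b -> (fun x => f x + g x) @ F --> a + b.
Proof. by move=> fa gb; have := cvgD fa gb; apply. Qed.

Lemma cvgCM T (F : set_system T) {FF : Filter F} (f g : T -> C) (a b : C) :
  f @ F --> a -> g @ F --> b -> (fun x => f x * g x) @ F --> a * b.
Proof. by move=> fa gb; have := cvgM fa gb; apply. Qed.

Lemma cvg_totallyP (I : choiceType) (f : {fset I} -> C) (l : C) :
  f @ totally --> l <-> forall e : R, 0 < e ->
    exists A0 : {fset I}, forall A, (A0 `<=` A)%fset -> normc (f A - l) < e.
Proof.
split=> [/cvg_normcP h e e0|h].
  by have [A0 _ hA] := h e e0; exists A0 => A AA0; exact: hA.
by apply/cvg_normcP => e /h[A0 hA]; exists A0 => // A /hA.
Qed.

Lemma cvg_totally_comp (I J : choiceType) (h : {fset J} -> {fset I}) (f : {fset I} -> C) (l : C) :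
  (forall A0, exists B0, forall B, (B0 `<=` B)%fset -> (A0 `<=` h B)%fset) ->
  f @ totally --> l -> (f \o h) @ totally --> l.
Proof.
move=> hc /cvg_totallyP hf; apply/cvg_totallyP => e /hf[A0 hA].
by have [B0 hB] := hc A0; exists B0 => B /hB/hA.
Qed.

Lemma cvg_totally_unique (I : choiceType) (f : {fset I} -> C) (l l' : C) :
  f @ totally --> l -> f @ totally --> l' -> l = l'.
Proof.
move=> /cvg_totallyP h /cvg_totallyP h'; apply/eqP; rewrite -subr_eq0; apply/eqP.
apply: normc_lt_eq0 => e e0.
have e2 : 0 < e / 2 by rewrite divr_gt0.
have [A hA] := h _ e2; have [B hB] := h' _ e2.
have := ltrD (hA _ (fsubsetUl A B)) (hB _ (fsubsetUr A B)).
rewrite -splitr; apply: le_lt_trans; rewrite [normc (f _ - l)]normcB.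
by apply: le_trans (le_normcD _ _); rewrite addrA subrK.
Qed.

Lemma cvg_totally_le (I : choiceType) (f : {fset I} -> C) (l : C) (B : R) :
  f @ totally --> l -> (forall A, normc (f A) <= B) -> normc l <= B.
Proof.
move=> /cvg_totallyP h fB; apply/ler_addgt0Pl => e /h[A hA].
rewrite -(subrK (f A) l); apply: le_trans (le_normcD _ _) _.
by rewrite lerD// normcB ltW// hA.
Qed.

Lemma cvg_totally_ge0 (I : choiceType) (f : {fset I} -> C) (l : C) :
  f @ totally --> l -> (forall A0, exists2 A, (A0 `<=` A)%fset & 0 <= f A) -> 0 <= l.
Proof.
move=> /cvg_totallyP h fB.
have key (e : R) : 0 < e -> exists2 r : R, 0 <= r & normc (r%:C - l) < e.
  move=> /h[A0 hA]; have [A /hA AA fA] := fB A0.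
  move: AA fA; rewrite lecE /=; case: (f A) => a b /= ab /andP[/eqP b0 a0].
  by exists a => //; move: ab; rewrite b0.
rewrite lecE /=; apply/andP; split.
  case: l key {h fB} => x y key /=.
  have [//|y0] := eqVneq y 0.
  have [r _] := key `|y| (ltac:(by rewrite normr_gt0)).
  move=> /(le_lt_trans (le_normc_Im _)).
  by rewrite [complex.Im _](_ : _ = - y) ?normrN ?ltxx// /= sub0r.
case: l key {h fB} => x y key /=; rewrite leNgt; apply/negP => x0.
have [r r0] := key (- x) (ltac:(by rewrite oppr_gt0)).
move=> /(le_lt_trans (le_normc_Re _)).
rewrite [complex.Re _](_ : _ = r - x) // => /(le_lt_trans (ler_norm _)).
by rewrite gtrDr ltNge r0.
Qed.

Section Sums.
Variable I : choiceType.
Implicit Types (f g : I -> C) (A B : {fset I}).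

Lemma partial_sumE f A : summability.partial_sum f A = \sum_(i <- A) f i.
Proof. by rewrite /summability.partial_sum big_seq_fsetE. Qed.

Lemma ler_sum_fsub (g : I -> R) A B : (forall i, 0 <= g i) -> (A `<=` B)%fset ->
  \sum_(i <- A) g i <= \sum_(i <- B) g i.
Proof.
move=> g0 AB; rewrite [leRHS](big_fsetID _ (mem A))/=.
rewrite (_ : [fset x in B | x \in A]%fset = A); last first.
  by apply/fsetP => x; rewrite !inE/= andb_idl// => /(fsubsetP AB).
by rewrite lerDl sumr_ge0.
Qed.

Lemma nneg_sum_converges (g : I -> R) (M : R) :
  (forall i, 0 <= g i) -> (forall A, \sum_(i <- A) g i <= M) ->
  exists s : R, [/\ sum_converges (fun i => (g i)%:C) s%:C, 0 <= s <= M &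
    forall A, \sum_(i <- A) g i <= s].
Proof.
move=> g0 gM; pose E := [set \sum_(i <- A) g i | A in [set: {fset I}]].
have hE : has_sup E.
  split; first by exists (\sum_(i <- fset0) g i); exists fset0.
  by exists M => _ [A _ <-].
have ub A : \sum_(i <- A) g i <= sup E by apply: ub_le_sup; [case: hE|exists A].
exists (sup E); split => //.
  apply/cvg_totallyP => e e0.
  have [_ [A0 _ <-] hA] := sup_adherent e0 hE.
  exists A0 => A A0A; rewrite partial_sumE -rmorph_sum -rmorphB normcR distrC.
  rewrite ger0_norm ?subr_ge0// ltrBlDr -ltrBlDl.
  by apply: lt_le_trans hA _; exact: ler_sum_fsub.
rewrite (le_trans _ (ub fset0)) ?big_seq_fset0//=.
by apply: sup_le_ub => [|_ [A _ <-]//]; case: hE.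
Qed.

Lemma sum_convergesD f g s t :
  sum_converges f s -> sum_converges g t -> sum_converges (fun i => f i + g i) (s + t).
Proof.
rewrite /sum_converges => fs gt.
rewrite (_ : summability.partial_sum _ =
  (fun A => summability.partial_sum f A + summability.partial_sum g A)).
  exact: (cvgCD fs gt).
by apply/funext => A; rewrite !partial_sumE big_split.
Qed.

Lemma sum_convergesZ a f s :
  sum_converges f s -> sum_converges (fun i => a * f i) (a * s).
Proof.
rewrite /sum_converges => fs.
rewrite (_ : summability.partial_sum _ =
  (fun A => a * summability.partial_sum f A)).
  exact: (cvgCM (cvg_cst a) fs).
by apply/funext => A; rewrite !partial_sumE mulr_sumr.
Qed.

Lemma sum_convergesB f g s t :
  sum_converges f s -> sum_converges g t -> sum_converges (fun i => f i - g i) (s - t).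
Proof.
move=> fs gt; rewrite -mulN1r [X in sum_converges X](_ : _ = fun i => f i + -1 * g i).
  exact/sum_convergesD/sum_convergesZ.
by apply/funext => i; rewrite mulN1r.
Qed.

(** Real and imaginary parts are split into [(|x| + x) / 2] and [(|x| - x) / 2], each nonnegative
    and at most [normc], so monotone convergence applies four times. *)
Lemma sum_converges_abs f (M : R) :
  (forall A, \sum_(i <- A) normc (f i) <= M) -> exists s, sum_converges f s.
Proof.
move=> fM.
have part (g : I -> R) : (forall i, 0 <= g i <= normc (f i)) ->
    exists s : R, sum_converges (fun i => (g i)%:C) s%:C.
  move=> g01; have [||s [hs _ _]] := @nneg_sum_converges g M.
  - by move=> i; have /andP[] := g01 i.
  - by move=> A; apply: le_trans (fM A); apply: ler_sum => i _; have /andP[] := g01 i.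
  by exists s.
have pos (h : C -> R) : (forall z, `|h z| <= normc z) -> forall i,
    0 <= (`|h (f i)| + h (f i)) / 2 <= normc (f i).
  move=> hB i; have := hB (f i); set z := f i => hz.
  have := ler_norm (h z); have := lerNnormlW (lexx `|h z|).
  by move=> ? ?; apply/andP; split; lra.
have neg (h : C -> R) : (forall z, `|h z| <= normc z) -> forall i,
    0 <= (`|h (f i)| - h (f i)) / 2 <= normc (f i).
  move=> hB i; have := hB (f i); set z := f i => hz.
  have := ler_norm (h z); have := lerNnormlW (lexx `|h z|).
  by move=> ? ?; apply/andP; split; lra.
have [s1 h1] := part _ (pos _ (@le_normc_Re R)).
have [s2 h2] := part _ (neg _ (@le_normc_Re R)).
have [s3 h3] := part _ (pos _ (@le_normc_Im R)).
have [s4 h4] := part _ (neg _ (@le_normc_Im R)).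
exists ((s1%:C - s2%:C) + 'i * (s3%:C - s4%:C)).
have -> : f = fun i => (((`|complex.Re (f i)| + complex.Re (f i)) / 2)%:C
      - ((`|complex.Re (f i)| - complex.Re (f i)) / 2)%:C) +
     'i * (((`|complex.Im (f i)| + complex.Im (f i)) / 2)%:C
      - ((`|complex.Im (f i)| - complex.Im (f i)) / 2)%:C).
  apply/funext => i; rewrite -!rmorphB /= {1}(complexE (f i)).
  by congr (_%:C + 'i * _%:C); lra.
exact: sum_convergesD (sum_convergesB h1 h2) (@sum_convergesZ 'i _ _ (sum_convergesB h3 h4)).
Qed.

Lemma sum_converges_unique f s s' :
  sum_converges f s -> sum_converges f s' -> s = s'.
Proof. exact: cvg_totally_unique. Qed.

Lemma unordered_sumE f s : sum_converges f s -> unordered_sum f = s.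
Proof.
by move=> fs; rewrite /unordered_sum (cvg_lim _ fs).
Qed.

Lemma sum_converges_fin f A : (forall i, i \notin A -> f i = 0) ->
  sum_converges f (\sum_(i <- A) f i).
Proof.
move=> fA; apply/cvg_totallyP => e e0; exists A => B AB.
rewrite partial_sumE (big_fsetID _ (mem A))/=.
rewrite (_ : [fset x in B | x \in A]%fset = A); last first.
  by apply/fsetP => x; rewrite !inE/= andb_idl// => /(fsubsetP AB).
rewrite addrAC subrr add0r big_seq big1 ?normc0// => i.
by rewrite !inE /= => /andP[_ /fA].
Qed.

End Sums.

End Limits.

(** * Power series *)

Section PowerSeries.
Variable R : realType.
Local Notation C := R[i].

Lemma near_dnbhs_normc (z : C) (Q : C -> Prop) (e : R) : 0 < e ->
  (forall y, y != z -> normc (y - z) < e -> Q y) -> \forall y \near z^', Q y.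
Proof.
move=> e0 h; rewrite /dnbhs /within /=; have e0' : 0 < e%:C :> C by rewrite ltcR.
apply/nbhs_ballP; exists e%:C => //= y.
by rewrite /ball /= normE ltcR normcB => yz yz'; apply: h.
Qed.

Lemma sum_expr_fset_le (t : R) (A : {fset nat}) : 0 <= t < 1 ->
  \sum_(i <- A) t ^+ i <= (1 - t)^-1.
Proof.
move=> /andP[t0 t1].
have [n An] : exists n, (A `<=` [fset i in iota 0 n])%fset.
  have H i : i \in A -> (i < (\max_(i <- A) i).+1)%N.
    by move=> iA; rewrite ltnS (@leq_bigmax_seq _ (enum_fset A) xpredT id i).
  move: _.+1 H => n H; exists n; apply/fsubsetP => i /H iA.
  by rewrite !inE mem_iota.
apply: (le_trans (@ler_sum_fsub _ _ (fun i => t ^+ i) _ _ _ An)) => [i|].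
  exact: exprn_ge0.
rewrite (perm_big (iota 0 n)) /=; last first.
  rewrite uniq_perm ?fset_uniq ?iota_uniq// => i; by rewrite !inE.
rewrite -{1}[n]subn0 -/(index_iota 0 n) big_mkord.
rewrite -[leRHS]mul1r ler_pdivlMr ?subr_gt0// mulrC.
have := subrXX 1 t n; rewrite expr1n => E.
rewrite (_ : _ * _ = 1 - t ^+ n) ?gerBl ?exprn_ge0// E; congr (_ * _).
by apply: eq_bigr => i _; rewrite expr1n mul1r.
Qed.

(** The Cauchy estimate for radius [rho]. It controls the sum in the open disc and is inherited by
    shifts and difference quotients. *)
Definition psbound (c : nat -> C) (B rho : R) : Prop :=
  forall k, normc (c k) * rho ^+ k <= B.

Definition psum (c : nat -> C) (z : C) : C := unordered_sum (fun k => c k * z ^+ k).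

Variables (rho : R).
Hypothesis rho0 : 0 < rho.

Lemma psum_absP (c : nat -> C) (B t : R) (z : C) (A : {fset nat}) :
  psbound c B rho -> 0 <= t < 1 -> normc z <= t * rho ->
  \sum_(i <- A) normc (c i * z ^+ i) <= B / (1 - t).
Proof.
move=> cB t01 zt; have B0 : 0 <= B.
  by apply: le_trans (cB 0%N); rewrite expr0 mulr1 normc_ge0.
have /andP[t0 t1] := t01.
apply: (@le_trans _ _ (\sum_(i <- A) B * t ^+ i)).
  apply: ler_sum => i _; rewrite normcM normcX.
  apply: (@le_trans _ _ (normc (c i) * (t * rho) ^+ i)).
    by rewrite ler_wpM2l ?normc_ge0// lerXn2r ?nnegrE ?normc_ge0 ?mulr_ge0// ltW.
  by rewrite exprMn mulrCA mulrC ler_wpM2r ?exprn_ge0.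
by rewrite -mulr_sumr ler_wpM2l// sum_expr_fset_le.
Qed.

Lemma lt_ratio (z : C) : normc z < rho -> exists2 t : R, 0 <= t < 1 & normc z <= t * rho.
Proof.
move=> zr; exists (normc z / rho); last by rewrite divfK// gt_eqF.
by rewrite divr_ge0 ?normc_ge0 ?(ltW rho0)//= ltr_pdivrMr// mul1r.
Qed.

Lemma psumP (c : nat -> C) (B : R) (z : C) : psbound c B rho -> normc z < rho ->
  sum_converges (fun k => c k * z ^+ k) (psum c z).
Proof.
move=> cB /lt_ratio[t t01 zt].
have [s hs] := sum_converges_abs (fun A => psum_absP A cB t01 zt).
by rewrite /psum (unordered_sumE hs).
Qed.

Lemma psum_poly (p : {poly C}) (u : C) : psum (fun n => p`_n) u = p.[u].
Proof.
rewrite /psum horner_coef -(big_mkord xpredT (fun i => p`_i * u ^+ i)).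
apply: unordered_sumE.
rewrite (perm_big [fset i in iota 0 (size p)]%fset) /=; last first.
  by apply: uniq_perm => [||i]; rewrite ?fset_uniq ?iota_uniq ?/index_iota ?subn0 ?iota_uniq// !inE.
apply: sum_converges_fin => i; rewrite !inE mem_iota /= add0n -leqNgt => pi.
by rewrite nth_default// mul0r.
Qed.

Lemma psum_le (c : nat -> C) (B t : R) (z : C) : psbound c B rho ->
  0 <= t < 1 -> normc z <= t * rho -> normc (psum c z) <= B / (1 - t).
Proof.
move=> cB t01 zt; have zr : normc z < rho.
  by apply: le_lt_trans zt _; case/andP: t01 => _ t1; rewrite gtr_pMl.
apply: (cvg_totally_le (psumP cB zr)) => A; rewrite partial_sumE.
by apply: le_trans (normc_sum _ _ _) _; exact: psum_absP.
Qed.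

Lemma sum_converges_nat_shift (f : nat -> C) s :
  sum_converges f s -> sum_converges (fun k => f k.+1) (s - f 0%N).
Proof.
move=> fs; pose h (B : {fset nat}) := (0%N |` [fset i.+1 | i in B])%fset.
have := @cvg_totally_comp R nat nat h _ s _ fs.
move=> /(_ _)/cvg_totallyP H; apply/cvg_totallyP => e /H[].
  move=> A0; exists [fset i.-1 | i in A0]%fset => B /fsubsetP AB.
  apply/fsubsetP => -[|i] iA; rewrite !inE//=; apply/imfsetP; exists i => //=.
  by apply: AB; apply/imfsetP; exists i.+1.
move=> A hA; exists A => B /hA /=; rewrite !partial_sumE /h.
rewrite big_fsetU1 /=; last by apply/imfsetP => -[].
rewrite big_imfset /=; last by move=> i j _ _ [].
by rewrite opprB addrA [f 0%N + _]addrC.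
Qed.

(* Coefficients of the difference quotient (psum c y - psum c z) / (y - z). *)
Definition psdiv (c : nat -> C) (z : C) (j : nat) : C := psum (fun i => c (j + i).+1) z.

Local Opaque psum.

Lemma psbound_shift (c : nat -> C) (B : R) (j : nat) : psbound c B rho ->
  psbound (fun i => c (j + i).+1) (B / rho ^+ j.+1) rho.
Proof.
move=> cB k; rewrite ler_pdivlMr ?exprn_gt0// -mulrA -exprD addnS addnC.
exact: cB.
Qed.

Lemma psum_shift (c : nat -> C) (B : R) (z : C) : psbound c B rho -> normc z < rho ->
  psum c z = c 0%N + z * psum (fun i => c i.+1) z.
Proof.
move=> cB zr; have h := sum_converges_nat_shift (psumP cB zr).
have h' := @sum_convergesZ _ _ z _ _ (psumP (psbound_shift 0 cB) zr).
apply/eqP; rewrite addrC -subr_eq; apply/eqP.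
have E : (fun k => c k.+1 * z ^+ k.+1) = (fun i => z * (c (0 + i)%N.+1 * z ^+ i)).
  by apply/funext => i; rewrite exprS mulrCA.
by rewrite expr0 mulr1 E in h; exact: (sum_converges_unique h h').
Qed.

Lemma psdiv_rec (c : nat -> C) (B : R) (z : C) j : psbound c B rho -> normc z < rho ->
  psdiv c z j = c j.+1 + z * psdiv c z j.+1.
Proof.
move=> cB zr; rewrite /psdiv (psum_shift (psbound_shift j cB) zr) addn0.
have -> : (fun i => c (j + i.+1).+1) = (fun i => c (j.+1 + i).+1); last by [].
by apply/funext => i; rewrite addnS.
Qed.

(** The shifted coefficients have bound [B / rho^(j+1)], and the geometric series of ratio
    [normc z / rho] contributes [1 / (1 - normc z / rho)]; together this is
    [B / (rho - normc z) / rho^j]. *)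
Lemma psbound_div (c : nat -> C) (B : R) (z : C) : psbound c B rho -> normc z < rho ->
  psbound (psdiv c z) (B / (rho - normc z)) rho.
Proof.
move=> cB zr j; have rz : 0 < rho - normc z by rewrite subr_gt0.
have t01 : 0 <= normc z / rho < 1.
  by rewrite divr_ge0 ?normc_ge0 ?(ltW rho0)//= ltr_pdivrMr// mul1r.
have := psum_le (psbound_shift j cB) t01 (_ : normc z <= normc z / rho * rho).
rewrite divfK ?gt_eqF// lexx => /(_ isT) h.
apply: le_trans (ler_wpM2r (exprn_ge0 j (ltW rho0)) h) _.
rewrite le_eqVlt; apply/orP; left; apply/eqP; rewrite exprS.
have r0 : rho != 0 by rewrite gt_eqF.
have ? : rho ^+ j != 0 by rewrite expf_neq0.
have ? : rho - normc z != 0 by rewrite gt_eqF.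
by field; apply/and3P.
Qed.

(** With [d = psdiv c z] and [D] its sum at [y], multiplying the recursion
    [c_(j+1) = d_j - z d_(j+1)] by [y^(j+1)] and summing gives [psum c y - c_0 = y D - z (D - d_0)],
    while [c_0 + z d_0] is [psum c z]. *)
Lemma psum_sub (c : nat -> C) (B : R) (z y : C) : psbound c B rho ->
  normc z < rho -> normc y < rho ->
  psum c y - psum c z = (y - z) * psum (psdiv c z) y.
Proof.
move=> cB zr yr; have dB := psbound_div cB zr; set d := psdiv c z.
have hd := psumP dB yr.
have hc := sum_converges_nat_shift (psumP cB yr).
have hd1 := sum_converges_nat_shift hd.
rewrite !expr0 !mulr1 in hc hd1.
have H := sum_convergesB (@sum_convergesZ _ _ y _ _ hd) (@sum_convergesZ _ _ z _ _ hd1).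
have E : (fun k => c k.+1 * y ^+ k.+1) =
    (fun j => y * (d j * y ^+ j) - z * (d j.+1 * y ^+ j.+1)).
  apply/funext => j; rewrite /d (psdiv_rec j cB zr) exprS.
  have ringE (K : comNzRingType) (b e y' z' a : K) :
    b * (y' * e) = y' * ((b + z' * a) * e) - z' * (a * (y' * e)) by ring.
  exact: ringE.
rewrite -E in H; have := sum_converges_unique hc H.
rewrite (psum_shift cB zr) (_ : psum (fun i => c i.+1) z = d 0%N)// => E'.
have ringE (K : comNzRingType) (a b c' d' y' z' : K) :
  a - c' = y' * b - z' * (b - d') -> a - (c' + z' * d') = (y' - z') * b.
  by move=> /(canRL (subrK _)) ->; ring.
exact: ringE.
Qed.

Lemma psum_lipschitz (c : nat -> C) (B : R) (z : C) : psbound c B rho -> normc z < rho ->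
  exists K e : R, [/\ 0 < K, 0 < e & forall y, normc (y - z) < e ->
    normc y < rho /\ normc (psum c y - psum c z) <= K * normc (y - z)].
Proof.
(* [t * rho] is the midpoint of [normc z] and [rho]: the quotient series is bounded uniformly on the
   disc of that radius, which contains a ball around [z]. The summand 1 below makes the Lipschitz
   constant positive. *)
move=> cB zr; pose t := (normc z + rho) / 2 / rho.
have tr : t * rho = (normc z + rho) / 2 by rewrite divfK ?gt_eqF.
have n0 := normc_ge0 z.
have t01 : 0 <= t < 1.
  by rewrite ltr_pdivrMr// mul1r !divr_ge0 ?addr_ge0// ?(ltW rho0)//=; lra.
have /andP[t0 t1] := t01.
have dB := psbound_div cB zr; set B' := B / _ in dB.
have B0 : 0 <= B'.
  by apply: le_trans (dB 0%N); rewrite expr0 mulr1 normc_ge0.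
exists (B' / (1 - t) + 1), ((rho - normc z) / 2); split.
- by rewrite ltr_wpDl// divr_ge0// subr_ge0 ltW.
- by rewrite divr_gt0// subr_gt0.
move=> y yz.
have yt : normc y <= t * rho.
  rewrite tr -(subrK z y); apply: le_trans (le_normcD _ _) _; lra.
have yr : normc y < rho by apply: le_lt_trans yt _; rewrite tr; lra.
split=> //; rewrite (psum_sub cB zr yr) normcM mulrC ler_wpM2r ?normc_ge0//.
by apply: le_trans (psum_le dB t01 yt) _; rewrite lerDl.
Qed.

Lemma psum_neq0_near (c : nat -> C) (B : R) (z : C) : psbound c B rho -> normc z < rho ->
  psum c z != 0 -> exists2 e : R, 0 < e &
    forall y, normc (y - z) < e -> normc y < rho /\ psum c y != 0.
Proof.
move=> cB zr cz; have [K [e [K0 e0 H]]] := psum_lipschitz cB zr.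
exists (Num.min e (normc (psum c z) / K)).
  by rewrite lt_min e0 divr_gt0// normc_gt0.
move=> y; rewrite lt_min (ltr_pdivlMr _ _ K0) => /andP[/H[yr yK] yc].
split; first exact: yr.
apply/eqP => y0; move: yK; rewrite y0 sub0r normcN leNgt => /negP; apply.
by rewrite mulrC.
Qed.

(** The difference quotient at [z] is the power series with coefficients [psdiv c z], itself
    Lipschitz near [z]; its value at [z] is the derivative. *)
Lemma derivable_psum (c : nat -> C) (B : R) (z : C) : psbound c B rho -> normc z < rho ->
  derivable (psum c) z 1.
Proof.
move=> cB zr; have dB := psbound_div cB zr.
have [K [e [K0 e0 H]]] := psum_lipschitz dB zr.
have quot (h : C) : h != 0 -> normc h < e ->
    normc (h^-1 *: ((psum c \o shift z) (h *: (1 : C)) - psum c z) - psum (psdiv c z) z)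
      <= K * normc h.
  move=> h0 he; have [] := H (h + z); first by rewrite addrK.
  rewrite addrK => hz hd.
  rewrite [h *: _]mulr1 /= (psum_sub cB zr hz) addrK.
  by rewrite [h^-1 *: _](_ : _ = psum (psdiv c z) (h + z)); last exact: mulKf.
have lim (eps : R) : 0 < eps -> \forall h \near (0 : C)^', normc (h^-1 *:
    ((psum c \o shift z) (h *: (1 : C)) - psum c z) - psum (psdiv c z) z) < eps.
  move=> eps0; apply: (@near_dnbhs_normc _ _ (Num.min e (eps / K))) => [|h h0].
    by rewrite lt_min e0 divr_gt0.
  rewrite subr0 lt_min => /andP[he hK].
  apply: le_lt_trans (quot h h0 he) _.
  by rewrite mulrC -ltr_pdivlMr.
by apply/cvg_ex; exists (psum (psdiv c z) z); apply/cvg_normcP.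
Qed.

Lemma psum0 (c : nat -> C) (B : R) : psbound c B rho -> psum c 0 = c 0%N.
Proof. by move=> cB; rewrite (psum_shift cB) ?mul0r ?addr0// normc0. Qed.

End PowerSeries.

(* Each zero at z can be divided out at most finitely often: dividing by y - z
   multiplies the constant coefficient by 1/|z|, but the weighted sup norm of
   radius 3|z| only by 1/(2|z|). *)
Local Opaque psum.
Lemma psum_isolated_zeros (R : realType) (c : nat -> R[i]) :
  (forall rho : R, 0 < rho -> exists B, psbound c B rho) -> c 0%N != 0 ->
  forall z, exists2 e : R, 0 < e &
    forall y, y != z -> normc (y - z) < e -> psum c y != 0.
Proof.
move=> cB c0 z; have [z0|z0] := eqVneq z 0.
  have [B B1] := cB 1 ltr01.
  have [||e e0 H] := @psum_neq0_near R 1 ltr01 c B z B1; rewrite ?z0 ?normc0//.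
    by rewrite (psum0 ltr01 B1).
  by rewrite -z0 in H *; exists e; [exact: e0|move=> y _ /H[]].
have zp : 0 < normc z by rewrite normc_gt0.
pose rho := 3 * normc z.
have rho0 : 0 < rho by rewrite mulr_gt0.
have zr : normc z < rho by rewrite /rho; lra.
have rz : rho - normc z = 2 * normc z by rewrite /rho; lra.
have [B hB] := cB _ rho0.
apply: contrapT => nex.
have div m : exists d, [/\ psbound d (B / (2 * normc z) ^+ m) rho,
    normc (d 0%N) = normc (c 0%N) / normc z ^+ m &
    forall y, normc y < rho -> psum c y = (y - z) ^+ m * psum d y].
  elim: m => [|m [d [dB d0 cd]]].
    by exists c; rewrite expr0 !divr1; split=> // y _; rewrite expr0 mul1r.
  (* Otherwise [d] has no zero near [z], hence [psum c] has none near [z] apart from possibly [z],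
     against [nex]. *)
  have dz : psum d z = 0.
    apply: contrapT => /eqP dz; apply: nex.
    have [e e0 H] := psum_neq0_near rho0 dB zr dz.
    exists e; first exact: e0.
    move=> y yz /H[yr dy]; rewrite (cd _ yr) mulf_neq0 ?dy// expf_neq0//.
    by rewrite subr_eq0.
  have d'B := psbound_div rho0 dB zr.
  exists (psdiv d z); split.
  - by rewrite exprSr invfM mulrA; rewrite rz in d'B.
  - have := psum_shift rho0 dB zr; rewrite dz => /esym/eqP.
    rewrite addr_eq0 => /eqP E.
    have -> : psdiv d z 0 = - d 0%N / z by rewrite E opprK mulrC mulKf.
    by rewrite normcM normcV normcN d0 exprSr invfM mulrA.
  - move=> y yr; rewrite (cd _ yr); have := psum_sub rho0 dB zr yr.
    by rewrite dz subr0 => ->; rewrite mulrA -exprSr.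
have c0p : 0 < normc (c 0%N) by rewrite normc_gt0.
(* The two estimates for the constant coefficient give [2^m * normc (c 0) <= B] for every [m]. *)
have ub m : m%:R <= B / normc (c 0%N).
  have [d [dB d0 _]] := div m; have := dB 0%N; rewrite expr0 mulr1 d0 exprMn.
  have zm : 0 < normc z ^+ m by rewrite exprn_gt0.
  rewrite invfM mulrA ler_pM2r ?invr_gt0// => h.
  rewrite ler_pdivlMr//; rewrite ler_pdivlMr ?exprn_gt0// mulrC in h.
  apply: le_trans h; rewrite ler_pM2r// -natrX ler_nat.
  by rewrite ltnW// ltn_expl.
have := ub (Num.truncn (B / normc (c 0%N))).+1.
by rewrite leNgt truncnS_gt.
Qed.

(** * Cofinal exhaustions and dominated convergence *)

Section MoreLimits.
Variable R : realType.
Local Notation C := R[i].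

(** The index type of the exhaustion is free, so one sum over words can be computed along finite
    sets of edges or along finite sets of primes. *)
Lemma sum_converges_cofinal (I J : choiceType) (f : I -> C) (s : C)
    (h : {fset J} -> seq I) :
  sum_converges f s -> (forall B, uniq (h B)) ->
  (forall A0 : {fset I}, exists B0, forall B, (B0 `<=` B)%fset ->
     forall i, i \in A0 -> f i != 0 -> i \in h B) ->
  (fun B => \sum_(i <- h B) f i) @ totally --> s.
Proof.
move=> /cvg_totallyP fs hu hc; apply/cvg_totallyP => e /fs[A0 hA0].
have [B0 hB0] := hc A0; exists B0 => B /hB0 hB.
(* Convergence is applied to [h B] enlarged by [A0]; the added terms are zero. *)
have := hA0 (A0 `|` [fset i in h B])%fset (fsubsetUl _ _).
rewrite partial_sumE; congr (normc (_ - _) < e).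
rewrite (big_fsetID _ (mem (h B))) /= [X in _ + X]big_seq [X in _ + X]big1; last first.
  move=> i; rewrite !inE /= => /andP[iAh ih].
  move: iAh; rewrite (negPf ih) orbF => iA.
  by apply/eqP/negPn/negP => fi; move: ih; rewrite (hB _ iA fi).
rewrite addr0; apply: perm_big; apply: uniq_perm => [||i].
- exact: fset_uniq.
- exact: hu.
- by rewrite !inE /=; case: (i \in h B); rewrite ?orbT ?andbF.
Qed.

Lemma cvgC_sum T (F : set_system T) {FF : Filter F} n (f : 'I_n -> T -> C) (a : 'I_n -> C) :
  (forall i, f i @ F --> a i) -> (fun x => \sum_i f i x) @ F --> \sum_i a i.
Proof.
move=> fa; elim: n f a fa => [|n IH] f a fa.
  rewrite big_ord0 [X in X @ _](_ : _ = fun=> 0); first exact: cvg_cst.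
  by apply/funext => x; rewrite big_ord0.
rewrite big_ord_recl [X in X @ _](_ : _ = fun x => f ord0 x + \sum_i f (lift ord0 i) x).
  by apply: cvgCD; [exact: fa|apply: IH => i; exact: fa].
by apply/funext => x; rewrite big_ord_recl.
Qed.

Lemma sum_converges_series (f : nat -> C) (s : C) :
  sum_converges f s -> series f @ \oo --> s.
Proof.
move=> /cvg_totallyP fs; apply/cvg_normcP => e /fs[A0 hA0].
exists (\max_(i <- A0) i).+1%N => // n /= An.
have := hA0 [fset i in iota 0 n]%fset.
rewrite partial_sumE /series /= (perm_big (iota 0 n)) /=; last first.
  by apply: uniq_perm => [||i]; rewrite ?fset_uniq ?iota_uniq// !inE.
rewrite /index_iota subn0; apply; apply/fsubsetP => i iA; rewrite !inE mem_iota/= add0n.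
by apply: leq_trans An; rewrite ltnS (@leq_bigmax_seq _ (enum_fset A0) xpredT id i).
Qed.

Lemma psum_shiftn (rho : R) (c : nat -> C) (B : R) (u : C) (N : nat) :
  0 < rho -> psbound c B rho -> normc u < rho ->
  psum c u = \sum_(n < N) c n * u ^+ n + u ^+ N * psum (fun n => c (N + n)%N) u.
Proof.
move=> rho0; elim: N c B => [|N IH] c B cB ur.
  by rewrite big_ord0 add0r expr0 mul1r.
rewrite (psum_shift rho0 cB ur).
have c'B : psbound (fun i => c i.+1) (B / rho) rho.
  by have := psbound_shift rho0 0 cB; rewrite expr1.
rewrite (IH _ _ c'B ur) big_ord_recl expr0 mulr1 mulrDr addrA; congr (_ + _ + _).
  rewrite mulr_sumr; apply: eq_bigr => i _.
  by rewrite lift0 exprS mulrCA.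
by rewrite mulrA -exprS.
Qed.

Lemma psbound_drop (rho : R) (c : nat -> C) (B : R) (N : nat) : 0 < rho ->
  psbound c B rho -> psbound (fun n => c (N + n)%N) (B / rho ^+ N) rho.
Proof.
move=> rho0 cB k; rewrite ler_pdivlMr ?exprn_gt0// -mulrA -exprD addnC; exact: cB.
Qed.

(** Tannery's argument: the common bound makes the tails past [N] uniformly small, while the first
    [N] coefficients converge one by one. *)
Lemma psum_dominated (J : choiceType) (rho B : R) (c : {fset J} -> nat -> C)
    (a : nat -> C) (u : C) :
  0 < rho -> (forall A, psbound (c A) B rho) -> psbound a B rho ->
  (forall n, (fun A => c A n) @ totally --> a n) -> normc u < rho ->
  (fun A => psum (c A) u) @ totally --> psum a u.
Proof.
move=> rho0 cB aB ca ur; have [t t01 ut] := lt_ratio rho0 ur.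
have /andP[t0 t1] := t01.
have B0 : 0 <= B by have := aB 0%N; apply: le_trans; rewrite expr0 mulr1 normc_ge0.
apply/cvg_totallyP => e e0.
(* The factor 2 accounts for two tails, that of [c A] and that of [a]. *)
pose K := 2 * (B / (1 - t)).
have K0 : 0 <= K by rewrite mulr_ge0// divr_ge0// subr_ge0 ltW.
have [N hN] : exists N, K * t ^+ N < e / 2.
  have := @cvg_geometric R K t; rewrite ger0_norm// => /(_ t1).
  move=> /cvgrPdist_lt /(_ (e / 2)) -/(_ (divr_gt0 e0 (ltr0Sn _ 1)))[N _ /(_ N (leqnn _))].
  rewrite /geometric /= sub0r normrN ger0_norm; last by rewrite mulr_ge0// exprn_ge0.
  by exists N.
have tail (c' : nat -> C) : psbound c' B rho ->
    normc (u ^+ N * psum (fun n => c' (N + n)%N) u) <= B / (1 - t) * t ^+ N.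
  move=> c'B; rewrite normcM normcX.
  have := psum_le rho0 (psbound_drop N rho0 c'B) t01 ut.
  move=> /(ler_wpM2l (exprn_ge0 N (normc_ge0 u)))/le_trans; apply.
  have : normc u ^+ N <= (t * rho) ^+ N.
    by rewrite lerXn2r ?nnegrE ?normc_ge0// mulr_ge0// ltW.
  have rN : 0 < rho ^+ N by rewrite exprn_gt0.
  rewrite exprMn -ler_pdivrMr// => h.
  have t1' : 0 <= B / (1 - t) by rewrite divr_ge0// subr_ge0 ltW.
  have := ler_wpM2l t1' h; apply: le_trans.
  by rewrite [leLHS](_ : _ = B / (1 - t) * (normc u ^+ N / rho ^+ N))//; ring.
have head : (fun A => \sum_(n < N) c A n * u ^+ n) @ totally --> \sum_(n < N) a n * u ^+ n.
  apply: cvgC_sum => i; apply: cvgCM; [exact: ca|exact: cvg_cst].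
have e2 : 0 < e / 2 by rewrite divr_gt0.
have [A0 hA0] := (cvg_totallyP _ _).1 head _ e2.
exists A0 => A /hA0 hA.
rewrite (psum_shiftn N rho0 (cB A) ur) (psum_shiftn N rho0 aB ur).
set S1 := \sum_(n < N) c A n * _ in hA *; set S2 := \sum_(n < N) _ in hA *.
have ringE (L : zmodType) (x y x' y' : L) : x + y - (x' + y') = (x - x') + (y - y').
  by rewrite opprD addrACA.
rewrite ringE; apply: le_lt_trans (le_normcD _ _) _.
have hT : 2 * (B / (1 - t) * t ^+ N) < e / 2 by rewrite mulrA.
have hX : normc (u ^+ N * psum (fun n => c A (N + n)%N) u
    - u ^+ N * psum (fun n => a (N + n)%N) u) <= 2 * (B / (1 - t) * t ^+ N).
  apply: le_trans (le_normcD _ _) _; rewrite normcN mulr_natl mulr2n.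
  exact: lerD (tail _ (cB A)) (tail _ aB).
rewrite [ltRHS]splitr; apply: ltrD; [exact: hA|exact: le_lt_trans hX hT].
Qed.

End MoreLimits.

(** * Closed paths as cyclic words of edges *)

Lemma onth_some (T : Type) (x0 : T) (s : seq T) i : (i < size s)%N ->
  onth s i = Some (nth x0 s i).
Proof. by elim: s i => [|x s IH] [|i] //= /IH. Qed.

Section EdgeWords.
Variables (V : choiceType) (X : sgraph V).
Local Notation E := (OE X).
Implicit Types (a b : E) (t : seq E) (p q : closed_path X).

Definition conn : rel E := fun a b => orig b == targ a.
Definition arrow : rel E := fun a b => conn a b && (b != rev_edge a).

(** A closed path with [n + 1] vertices becomes a word of [n] edges, and the shift that drops one
    endpoint and repeats the other becomes a plain rotation. [tour] is the inverse on cyclic words: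
    it starts at the target of the last edge, which is the origin of the first. *)
Definition edges (p : seq V) : seq E := pmap insub (zip p (behead p)).
Definition tour t : seq V :=
  if t is e :: t' then last (targ e) (map (@targ V X) t') :: map (@targ V X) t else [::].

Lemma edges_cons x y s (xy : X x y) :
  edges [:: x, y & s] = (exist _ (x, y) xy : E) :: edges (y :: s).
Proof.
rewrite /edges /= /oapp; case: insubP => [e _ eE|]; last by rewrite /= xy.
by congr (_ :: _); apply: val_inj; rewrite eE.
Qed.

Lemma edges_path x s : path X x s ->
  [/\ map (@targ V X) (edges (x :: s)) = s,
     map val (edges (x :: s)) = zip (x :: s) s &
     forall a, targ a = x -> path conn a (edges (x :: s))].
Proof.
elim: s x => [|y s IH] x //= /andP[xy /IH[IH1 IH2 IH3]].
rewrite (edges_cons s xy); split=> [| |a ax] /=; first by rewrite IH1.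
  by rewrite IH2.
by rewrite /conn /orig ax eqxx /= IH3.
Qed.

Lemma path_conn a t : path conn a t ->
  path X (targ a) (map (@targ V X) t) /\ edges (targ a :: map (@targ V X) t) = t.
Proof.
elim: t a => [|b t IH] a //= /andP[/eqP ab /IH[IH1 IH2]].
have bX : X (targ a) (targ b) by rewrite -ab; exact: (valP b).
split; first by rewrite bX.
rewrite (edges_cons _ bX) IH2; congr (_ :: _); apply: val_inj => /=.
by rewrite -ab; case: b {ab IH1 IH2 bX} => -[].
Qed.

Lemma closedP p : exists x s, val p = last x s :: x :: s /\ path X (last x s) (x :: s).
Proof.
case: p => -[|x0 [|x s]] //= pP; exists x, s.
case/and3P: (pP) => /andP[_ /= pX] _ /= /eqP/esym/(onth_nth x) x0E.
by rewrite (last_nth x) x0E.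
Qed.

Lemma edges_closed p : [/\ edges p != [::], cycle conn (edges p),
  tour (edges p) = p, map val (edges p) = zip p (behead p) &
  size (edges p) = path_length p].
Proof.
have [x [s [-> pX]]] := closedP p; have [E1 E2 E3] := edges_path pX.
have [a [t tE]] : exists a t, edges (last x s :: x :: s) = a :: t.
  by case: edges E1 => // a t; exists a, t.
have la : targ (last a t) = last x s.
  by have := congr1 (last x) E1; rewrite tE /= (last_map (@targ V X)).
split=> //.
- by rewrite tE.
- by rewrite tE (cycle_path a) -tE; apply: E3; rewrite tE.
- by rewrite tE /tour (last_map (@targ V X)) la -tE E1.
- by rewrite -(size_map (@targ V X)) E1.
Qed.

Lemma tour_closed t : t != [::] -> cycle conn t ->
  is_closed X (tour t) /\ edges (tour t) = t.
Proof.
case: t => // a t _; rewrite (cycle_path a) => pt.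
have [h1 h2] := path_conn pt; rewrite /tour (last_map (@targ V X)).
split; last exact: h2.
rewrite /is_closed /is_path /=; move: h1 => /= ->; rewrite /= /path_length /=.
have := @onth_some _ (targ a) (targ a :: map (@targ V X) t) (size (map (@targ V X) t)) (leqnn _).
by rewrite -last_nth (last_map (@targ V X)) => ->; exact: eqxx.
Qed.

Definition closed_of t (h : (t != [::]) && cycle conn t) : closed_path X :=
  let: conj t0 tc := andP h in ClosedPath (tour_closed t0 tc).1.

Lemma edges_closed_of t h : edges (@closed_of t h) = t.
Proof. by rewrite /closed_of; case: (andP h) => t0 tc; case: (tour_closed t0 tc). Qed.

Lemma edges_inj p q : edges p = edges q -> p = q.
Proof.
case: (edges_closed p) => _ _ pE _ _; case: (edges_closed q) => _ _ qE _ _ pq.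
by apply: val_inj; rewrite /= -pE pq qE.
Qed.

Lemma shift_relE p q : shift_rel p q <-> edges q = rot 1 (edges p).
Proof.
split=> [/shift_relP[x [s [pE qE]]]|qp].
  case: (edges_closed p) => _ _ _ pz _; case: (edges_closed q) => _ _ _ qz _.
  apply: (inj_map val_inj); rewrite qz map_rot pz.
  rewrite -!/(val _) pE qE /= zip_rcons_shift /rot /=.
  by rewrite take0 cats1 drop0.
have [x [s [pE pX]]] := closedP p; have [y [u [qE qX]]] := closedP q.
have [p1 _ _] := edges_path pX; have [q1 _ _] := edges_path qX.
have : y :: u = rcons s x.
  by rewrite -q1 -qE qp map_rot pE p1 /rot /= drop0 take0 cats1.
rewrite /shift_rel pE qE => yu; rewrite yu /=; congr (_ :: _).
by rewrite -[last y u]/(last x (y :: u)) yu last_rcons.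
Qed.

Lemma cycle_relE p q : cycle_rel p q <-> exists k, edges q = iter k (rot 1) (edges p).
Proof.
split=> [/asboolP|[k]].
  elim=> {p q} [p q /shift_relE ->|p|p q _ [k qE]|p q r _ [k ->] _ [l ->]].
  - by exists 1%N.
  - by exists 0%N.
  - have [p0 _ _ _ _] := edges_closed p; have s0 : (0 < size (edges p))%N.
      by rewrite lt0n size_eq0.
    (* For a word of length [n], [k] unit rotations are undone by [k n - k] further ones. *)
    exists (k * size (edges p) - k)%N; rewrite qE -iterD subnK ?leq_pmulr//.
    by apply/esym/eqP; rewrite iter_rot_fixed dvdn_mull ?period_dvd_size.
  - by exists (l + k)%N; rewrite iterD.
elim: k q => [|k IH] q qE; first by rewrite (edges_inj qE) cycle_rel_refl.
have [p0 pc _ _ _] := edges_closed p.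
have h : (iter k (rot 1) (edges p) != [::]) && cycle conn (iter k (rot 1) (edges p)).
  elim: k {IH qE} => [|k /andP[IH1 IH2]] /=; first by rewrite p0 pc.
  by rewrite rot_cycle IH2 andbT -size_eq0 size_rot size_eq0.
apply: (@cycle_rel_trans _ _ (closed_of h)); first by apply: IH; rewrite edges_closed_of.
apply/asboolP; apply: rst_step; apply/shift_relE.
by rewrite edges_closed_of qE.
Qed.

Lemma eq_gcycleP p q : \pi_(gcycle X) p = \pi_(gcycle X) q <->
  exists k, edges q = iter k (rot 1) (edges p).
Proof. by rewrite -cycle_relE; split=> /eqmodP. Qed.

(** The inner steps of the cyclic word encode reducedness, and the step from the last edge back to
    the first is the absence of a tail. *)
Lemma arrow_cycle p : cycle arrow (edges p) <-> reduced p /\ ~ has_tail p.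
Proof.
have [p0 pc _ pz ps] := edges_closed p; set n := path_length p in ps *.
have [x [s [pE pX]]] := closedP p.
have sp : size p = n.+1 by rewrite /n /path_length -/(val p) pE.
have n0 : (0 < n)%N by rewrite -ps lt0n size_eq0.
have [a [t tE]] : exists a t, edges p = a :: t.
  by case: edges p0 => // a t _; exists a, t.
pose y i := nth x p i.
have nE i : (i < n)%N -> val (nth a (edges p) i) = (y i, y i.+1).
  move=> ni; rewrite -(nth_map _ (x, x) val) ?ps// pz nth_zip_cond size_zip size_behead.
  by rewrite sp /= (minn_idPr (leqnSn n)) ni /= nth_behead.
have arrowE i j : (i < n)%N -> (j < n)%N -> conn (nth a (edges p) i) (nth a (edges p) j) ->
    arrow (nth a (edges p) i) (nth a (edges p) j) = (y j.+1 != y i).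
  move=> ni nj cij; rewrite /arrow cij /=; congr negb.
  move: cij; rewrite /conn /orig /targ nE// nE//= => /eqP cij.
  by rewrite -val_eqE /= nE// /rev_edge /orig /targ /= nE// xpair_eqE cij eqxx.
have lastE : last a (edges p) = nth a (edges p) n.-1 by rewrite -nth_last ps.
have pc' i : (i < n)%N -> conn (nth a (last a (edges p) :: edges p) i) (nth a (edges p) i).
  move=> ni; move: pc; rewrite {1}tE (cycle_path a) -tE => /(pathP a); apply.
  by rewrite ps.
have -> : cycle arrow (edges p) <-> (y 1%N != y n.-1) /\
    forall i, (i.+1 < n)%N -> y i.+2 != y i.
  rewrite {1}tE (cycle_path a) -tE; split=> [/(pathP a) H|[H1 H2]].
    split=> [|i ni].
      have := H 0%N; rewrite ps n0 => /(_ isT) /=; rewrite lastE arrowE ?prednK//.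
      by rewrite -lastE; exact: (pc' 0%N).
    by have := H i.+1; rewrite ps ni => /(_ isT) /=; rewrite arrowE ?(ltnW ni)//; exact: (pc' i.+1).
  apply/(pathP a) => -[|i]; rewrite ps => ni /=.
    by rewrite lastE arrowE ?prednK// -lastE; exact: (pc' 0%N).
  by rewrite arrowE ?(ltnW ni)// ?H2//; exact: (pc' i.+1).
have oE i : (i <= n)%N -> onth p i = Some (y i) by move=> ni; rewrite (onth_some x) ?sp.
rewrite /reduced /has_tail -/n subn1 !oE//; last by rewrite leq_pred.
split=> [[/eqP H1 H2]|[H1 H2]]; split.
- move=> [//|j] /andP[_ jn]; have nj : (j.+1 < n)%N by lia.
  by rewrite -pred_Sn !oE ?(ltnW (ltnW nj))// => -[yj]; have := H2 _ nj; rewrite yj eqxx.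
- by move=> [].
- by apply/eqP => y1; apply: H2; rewrite y1.
- move=> i ni; apply/eqP => yi; apply: (H1 i.+1); first by lia.
  by rewrite -pred_Sn !oE ?yi//; lia.
Qed.

Lemma regularP (c : gcycle X) : regular c <-> cycle arrow (edges (repr c)).
Proof.
split=> [h|h p pc]; first by apply/arrow_cycle/h; rewrite reprK.
apply/arrow_cycle; move: pc; rewrite -{1}(reprK c) => /esym/eq_gcycleP[k ->].
by elim: k => //= k; rewrite rot_cycle.
Qed.

Lemma tour_pow m t : t != [::] -> tour (pow m.+1 t) = path_power m.+1 (tour t).
Proof.
case: t => // a t _.
have tourE b u : tour (b :: u) = targ (last b u) :: map (@targ V X) (b :: u).
  by rewrite /tour (last_map (@targ V X)).
have -> : pow m.+1 (a :: t) = a :: (t ++ pow m (a :: t)) by [].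
have := @last_pow _ a m (a :: t) isT; rewrite powS last_cat => lE.
have -> : path_power m.+1 (tour (a :: t)) =
    targ (last a t) :: map (@targ V X) (pow m.+1 (a :: t)).
  by rewrite tourE /path_power /pow map_flatten map_nseq.
rewrite tourE last_cat; congr (targ _ :: _); exact: lE.
Qed.

(** If the edge word is a power, its block is itself cyclic and so defines a closed path.
    Conversely, primitivity passes to all members of the class because rotation preserves the
    period. *)
Lemma prime_cycleP (c : gcycle X) : prime_cycle c <-> primitive (edges (repr c)).
Proof.
have [p0 pc pE _ _] := edges_closed (repr c); split=> [h|h [p [q [m [m1 pE' qE]]]]].
  apply/primitive_pow; split=> // m b m1; apply/eqP => bE; apply: h.
  have b0 : b != [::].
    by apply: contraNneq p0 => b0; rewrite bE b0 -size_eq0 size_pow muln0.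
  have bc : cycle conn b by rewrite -(cycle_pow _ b0 (ltnW m1)) -bE.
  have h : (b != [::]) && cycle conn b by rewrite b0.
  exists (repr c), (closed_of h), m; split; rewrite ?reprK//.
  rewrite -[LHS]/(cp_seq (repr c)) -pE bE; case: m m1 {bE} => // m _; rewrite tour_pow//.
  by have [_ _ <- _ _] := edges_closed (closed_of h); rewrite edges_closed_of.
have [q0 qc tq _ _] := edges_closed q.
have pq : edges p = pow m (edges q).
  have t0 : pow m (edges q) != [::].
    by rewrite -size_eq0 size_pow muln_eq0 negb_or size_eq0 q0 -lt0n ltnW.
  have tc : cycle conn (pow m (edges q)) by rewrite cycle_pow// ltnW.
  rewrite -[RHS](tour_closed t0 tc).2 -/(val p) qE; congr edges.
  by case: m m1 {qE t0 tc} => // m _; rewrite tour_pow// tq.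
move: pE'; rewrite -{1}(reprK c) => /esym/eq_gcycleP[k pk].
have : primitive (edges p).
  rewrite pk; elim: k {pk} => //= k IH; have [i0 _] := (primitive_pow _).1 IH.
  by rewrite primitive_rot// lt0n size_eq0.
by move=> /primitive_pow[_ /(_ m (edges q) m1)]; rewrite pq eqxx.
Qed.

Lemma path_weight_edges (R : realType) (w : E -> R) p :
  path_weight w p = \prod_(e <- edges p) w e.
Proof.
have [_ _ _ pz _] := edges_closed p.
rewrite /path_weight -pz big_map; apply: eq_bigr => e _.
by rewrite /wt -surjective_pairing valK.
Qed.

Lemma cycle_length_edges (c : gcycle X) : cycle_length c = size (edges (repr c)).
Proof. by have [_ _ _ _ ->] := edges_closed (repr c). Qed.

End EdgeWords.

(** * Weights of cyclic words and their prime roots *)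

Section Walks.
Variables (R : realType) (V : choiceType) (X : sgraph V) (w : OE X -> R).
Local Notation E := (OE X).
Local Notation C := R[i].
Hypothesis w_ge0 : forall e, 0 <= w e.

(** A word has a first edge, so its distinct rotations count separately. The value 0 elsewhere
    allows sums over arbitrary sets of words. *)
Definition walk_weight (i : nat) (t : seq E) : R :=
  if (size t == i) && cycle (@arrow V X) t then \prod_(e <- t) w e else 0.

Lemma prodw_ge0 (t : seq E) : 0 <= \prod_(e <- t) w e.
Proof. by apply: prodr_ge0 => e _. Qed.

Lemma walk_weight_ge0 i t : 0 <= walk_weight i t.
Proof. by rewrite /walk_weight; case: ifP => // _; exact: prodw_ge0. Qed.

Lemma sum_words (F : {fset E}) (i : nat) :
  \sum_(t <- words F i) \prod_(e <- t) w e = (\sum_(e <- F) w e) ^+ i.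
Proof.
elim: i => [|i IH]; first by rewrite big_seq1 big_nil.
rewrite big_allpairs_dep exprS mulr_suml; apply: eq_bigr => e _.
by rewrite -IH mulr_sumr; apply: eq_bigr => t _; rewrite big_cons.
Qed.

Lemma words_cover (A : {fset seq E}) (i : nat) : exists F : {fset E},
  forall t, t \in A -> size t == i -> t \in words F i.
Proof.
exists [fset e in flatten A]%fset => t tA st; rewrite mem_words st.
apply/allP => e et; suff : e \in [fset e in flatten A]%fset by [].
by rewrite !inE; apply/flattenP; exists t.
Qed.

(** Dropping cyclicity leaves all words of length [i] over a finite alphabet, and their weights sum
    to the power of a sum. *)
Lemma walk_weight_sum_le (W : R) (A : {fset seq E}) (i : nat) :
  (forall F : {fset E}, \sum_(e <- F) w e <= W) ->
  \sum_(t <- A) walk_weight i t <= W ^+ i.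
Proof.
move=> wW; have [F FA] := words_cover A i.
apply: (@le_trans _ _ (\sum_(t <- words F i) \prod_(e <- t) w e)); last first.
  by rewrite sum_words lerXn2r ?nnegrE ?(le_trans _ (wW F))// sumr_ge0.
pose B := [fset t in words F i]%fset.
rewrite [leRHS](perm_big B) /=; last first.
  apply: uniq_perm => [||t]; [exact/words_uniq/fset_uniq|exact: fset_uniq|].
  by rewrite !inE.
rewrite [leLHS](big_fsetID _ (mem B))/= [X in _ + X <= _]big_seq [X in _ + X <= _]big1 ?addr0; last first.
  move=> t; rewrite !inE/= => /andP[tA tB]; rewrite /walk_weight.
  by case: (boolP (size t == i)) => // /(FA _ tA); rewrite (negPf tB).
apply: (@le_trans _ _ (\sum_(t <- B) walk_weight i t)).
  apply: ler_sum_fsub => [t|]; first exact: walk_weight_ge0.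
  by apply/fsubsetP => t; rewrite !inE => /andP[].
by apply: ler_sum => t _; rewrite /walk_weight; case: ifP => // _; exact: prodw_ge0.
Qed.

Section Trace.
Variable F : {fset E}.

Definition edge_nth (a : 'I_#|` F|) : E := tnth (in_tuple (enum_fset F)) a.

(** Row [a] holds the coordinates in [F] of the image of the edge [a] under [T]. This is the
    transpose of the usual matrix of the compression and has the same principal minors and traces of
    powers. *)
Definition edge_mx : 'M[C]_#|` F| := \matrix_(a, b)
  (if arrow (edge_nth a) (edge_nth b) then w (edge_nth b) else 0)%:C.

Lemma big_edge_nth (g : E -> C) : \sum_(e <- F) g e = \sum_a g (edge_nth a).
Proof. by rewrite big_tnth. Qed.

Lemma edge_mx_pow (i : nat) a b : (edge_mx ^+ i.+1) a b =
  \sum_(t <- words F i) (if path (@arrow V X) (edge_nth a) (rcons t (edge_nth b))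
     then \prod_(e <- rcons t (edge_nth b)) w e else 0)%:C.
Proof.
elim: i a => [|i IH] a.
  by rewrite expr1 big_seq1 /= andbT big_seq1 mxE.
rewrite exprS [LHS]mxE big_allpairs_dep big_edge_nth; apply: eq_bigr => c _.
rewrite IH mulr_sumr; apply: eq_bigr => t _; rewrite mxE /= -rmorphM.
congr (_%:C); rewrite big_cons.
by case: ifP => _; rewrite ?mul0r//=; case: ifP => _; rewrite ?mulr0.
Qed.

Lemma trace_edge_mx (i : nat) : \tr (edge_mx ^+ i.+1) =
  \sum_(t <- words F i.+1) (walk_weight i.+1 t)%:C.
Proof.
rewrite /mxtrace big_allpairs_dep big_edge_nth; apply: eq_bigr => a _.
rewrite edge_mx_pow big_seq [RHS]big_seq; apply: eq_bigr => t.
rewrite mem_words => /andP[/eqP st _]; rewrite /walk_weight [size _]/= st eqxx.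
by rewrite -[cycle _ _]/(path _ _ _) -cats1 big_cat big_seq1 big_cons/= mulrC.
Qed.

End Trace.

Section Primes.
Local Notation primes := (@regular_primes V X).
Implicit Type c : primes.

Definition prime_word c : seq E := edges X (repr (val c)).

Lemma prime_wordP c : [/\ prime_word c != [::], cycle (@arrow V X) (prime_word c) &
  primitive (prime_word c)].
Proof.
have [rc pc] : regular (val c) /\ prime_cycle (val c) by have /set_mem := valP c.
split; first by have [] := edges_closed (repr (val c)).
  exact: (regularP _).1 rc.
exact: (prime_cycleP _).1 pc.
Qed.

Lemma prime_word_inj c c' k k' : (k' <= size (prime_word c'))%N ->
  iter k (rot 1) (prime_word c) = rot k' (prime_word c') -> c = c'.
Proof.
move=> k's E; apply/val_inj; rewrite -[LHS]reprK -[RHS]reprK; apply/eq_gcycleP.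
exists (size (prime_word c') - k' + k)%N; rewrite iterD E -iter_rot// -iterD.
by rewrite subnK// iter_rot// rot_size.
Qed.

Definition prime_walks (A : {fset primes}) (i : nat) : seq (seq E) :=
  [seq pow (i %/ size (prime_word c))%N (rot k (prime_word c)) |
     c <- [seq c <- A | (size (prime_word c) %| i)%N], k <- iota 0 (size (prime_word c))].

(** Primitive roots are unique, so equal powers have equal rotated roots; words of different primes
    are never rotations of each other, and offsets below the length give distinct rotations of a
    primitive word. *)
Lemma prime_walks_uniq A i : (0 < i)%N -> uniq (prime_walks A i).
Proof.
move=> i0; apply: allpairs_uniq_dep => [||[c k] [c' k']].
- by rewrite filter_uniq ?fset_uniq.
- by move=> c _; exact: iota_uniq.
move=> /allpairsPdep[c1 [k1 [+ + [? ?]]]]; subst c1 k1.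
rewrite mem_filter mem_iota /= => /andP[ci _] kc.
move=> /allpairsPdep[c1 [k1 [+ + [? ?]]]]; subst c1 k1.
rewrite mem_filter mem_iota /= => /andP[c'i _] k'c' E.
have [c0 _ pc] := prime_wordP c; have [c'0 _ pc'] := prime_wordP c'.
have pr : primitive (rot k (prime_word c)) by rewrite primitive_rot// ltnW.
have pr' : primitive (rot k' (prime_word c')) by rewrite primitive_rot// ltnW.
have d0 : (0 < i %/ size (prime_word c))%N by exact: divn_size_gt0.
have d0' : (0 < i %/ size (prime_word c'))%N by exact: divn_size_gt0.
have {}E := pow_primitive_inj pr pr' d0 d0' E.
have cc : c = c'.
  apply: (@prime_word_inj _ _ k k' (ltnW k'c')).
  by rewrite (iter_rot (ltnW kc)); exact: E.
by subst c'; rewrite (rot_primitive_inj pc kc k'c' E).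
Qed.

Lemma cycle_weightE c : cycle_weight w (val c) = \prod_(e <- prime_word c) w e.
Proof. exact: path_weight_edges. Qed.

Lemma prod_pow m (t : seq E) : \prod_(e <- pow m t) w e = (\prod_(e <- t) w e) ^+ m.
Proof.
by elim: m => [|m IH]; rewrite ?big_nil// powS big_cat /= IH exprS.
Qed.

Lemma prod_rot k (t : seq E) : \prod_(e <- rot k t) w e = \prod_(e <- t) w e.
Proof. by apply: perm_big; rewrite perm_rot. Qed.

Lemma sum_prime_walks (A : {fset primes}) (i : nat) : (0 < i)%N ->
  \sum_(t <- prime_walks A i) (walk_weight i t)%:C =
  \sum_(c <- A) ((cycle_length (val c))%:R *
     (cycle_weight w (val c))%:C ^+ (i %/ cycle_length (val c))%N) *+
       (cycle_length (val c) %| i)%N.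
Proof.
move=> i0; rewrite big_allpairs_dep big_filter [LHS]big_mkcond /=.
apply: eq_bigr => c _; rewrite cycle_length_edges -/(prime_word c).
case: ifP => ci; last by rewrite mulr0n.
rewrite mulr1n cycle_weightE; have [c0 cc pc] := prime_wordP c.
rewrite big_seq (eq_bigr (fun=> ((\prod_(e <- prime_word c) w e)%:C
    ^+ (i %/ size (prime_word c))%N))); last first.
  move=> k; rewrite mem_iota add0n => /andP[_ kc].
  rewrite /walk_weight size_pow size_rot divnK// eqxx cycle_pow ?rot_cycle.
  - by rewrite cc prod_pow prod_rot rmorphXn.
  - by rewrite -size_eq0 size_rot size_eq0.
  - exact: divn_size_gt0.
by rewrite -big_seq big_const_seq count_predT size_iota iter_addr_0 mulr_natl.
Qed.

Lemma prime_walks_cover i t : (0 < i)%N -> walk_weight i t != 0 ->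
  exists c, forall A : {fset primes}, c \in A -> t \in prime_walks A i.
Proof.
rewrite /walk_weight; case: ifP => [/andP[/eqP st tc] i0 _|]; last by rewrite eqxx.
have t0 : t != [::] by rewrite -size_eq0 st -lt0n.
have p0 := period_gt0 t; have pd := period_dvd_size t0.
have ple := period_le_size t0.
set r := take (period t) t.
have rs : size r = period t by rewrite size_takel.
have tE : t = pow (i %/ period t)%N r.
  by rewrite -st {1}(rot_fixed_pow p0 pd (rot_period t0)).
have r0 : r != [::] by rewrite -size_eq0 rs -lt0n.
have ip0 : (0 < i %/ period t)%N by rewrite divn_gt0// -st.
have rc : cycle (@arrow V X) r by rewrite -(cycle_pow _ r0 ip0) -tE.
have rc' : (r != [::]) && cycle (@conn V X) r.
  rewrite r0; case: (r) rc => // a u; apply: sub_path => x y.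
  by case/andP.
(* The prime is the class of the primitive root [r]; its chosen representative may start at another
   edge, hence an offset. *)
pose c0 := \pi_(gcycle X) (closed_of rc').
have [k] := (eq_gcycleP (repr c0) (closed_of rc')).1 (reprK _).
rewrite edges_closed_of; set s := edges X (repr c0) => rk.
have ss : size s = period t.
  rewrite -rs rk; elim: (k) => //= j; by rewrite size_rot.
have s0 : s != [::] by rewrite -size_eq0 ss -lt0n.
have sc : cycle (@arrow V X) s.
  by move: rc; rewrite rk; elim: (k) => //= j IH; rewrite rot_cycle => /IH.
have {}rk : r = rot (k %% size s)%N s.
  rewrite -iter_rot; last by rewrite ltnW// ltn_pmod// ss.
  rewrite rk {1}(divn_eq k (size s)) addnC iterD; congr (iter _ _ _).
  by apply/eqP; rewrite iter_rot_fixed dvdn_mull// period_dvd_size.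
have kl : (k %% size s < size s)%N by rewrite ltn_pmod// ss.
have sp : primitive s by rewrite -(primitive_rot (ltnW kl)) -rk primitive_root.
have cP : regular_primes c0 by split; [apply/regularP|apply/prime_cycleP].
exists (exist _ c0 (mem_set cP) : primes) => A cA.
apply/allpairsPdep; exists (exist _ c0 (mem_set cP)), (k %% size s)%N.
split; last by rewrite tE rk -ss.
- by rewrite mem_filter cA andbT /prime_word /= -/s ss -st.
- by rewrite mem_iota.
Qed.

End Primes.

End Walks.

(** * The coefficients of the determinant and of the Euler product *)

Section Minors.
Variables (R : realType) (V : choiceType) (X : sgraph V) (w : OE X -> R).
Local Notation E := (OE X).
Local Notation C := R[i].
Hypothesis w_ge0 : forall e, 0 <= w e.

Lemma valency_size (M : nat) (x : V) (s : seq V) :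
  ([set y | X x y] #<= `I_M)%card -> uniq s -> all (X x) s -> (size s <= M)%N.
Proof.
move=> /pcard_leP/unsquash f us /allP sx; rewrite -(size_map f s) -[leqRHS](size_iota 0).
apply: uniq_leq_size.
  rewrite map_inj_in_uniq// => y z /sx xy /sx xz.
  by apply: inj; apply/mem_set.
move=> _ /mapP[y /sx xy ->]; rewrite mem_iota /= add0n.
exact: (@funS _ _ _ _ f y xy).
Qed.

Lemma indegree_le (M : nat) (v : V) (s : seq E) :
  (forall x, ([set y | X x y] #<= `I_M)%card) -> uniq s ->
  (forall a, a \in s -> targ a = v) -> (size s <= M)%N.
Proof.
move=> hM us sv; rewrite -(size_map (@orig V X)).
apply: (valency_size (hM v)).
  rewrite map_inj_in_uniq// => a a' /sv av /sv a'v aa'.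
  apply: val_inj; rewrite (surjective_pairing (val a)) (surjective_pairing (val a')).
  by rewrite -!/(orig _) -!/(targ _) aa' av a'v.
apply/allP => _ /mapP[a /sv <- ->] /=; rewrite adj_sym; exact: (valP a).
Qed.

Variables (M : nat).
Hypothesis valM : forall x, ([set y | X x y] #<= `I_M)%card.

Lemma edge_nth_inj (F : {fset E}) : injective (@edge_nth V X F).
Proof. by apply/tuple_uniqP; exact: fset_uniq. Qed.

Lemma edge_nthP (F : {fset E}) e : reflect (exists a, e = @edge_nth V X F a) (e \in F).
Proof. exact: (@tnthP _ _ (in_tuple (enum_fset F))). Qed.

Lemma prod_edge_nth (F : {fset E}) (g : E -> R) :
  \prod_(a : 'I_#|` F|) g (edge_nth a) = \prod_(e <- F) g e.
Proof. by rewrite [RHS]big_tnth. Qed.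

Lemma det_edge_mx_le (J : {fset E}) :
  normc (\det (edge_mx w J)) <= \prod_(e <- J) (M%:R * w e).
Proof.
rewrite -det_tr; apply: le_trans (normc_sum _ _ _) _.
apply: (@le_trans _ _ (\sum_(s : 'S_#|` J|) \prod_b normc (edge_mx w J (s b) b))).
  apply: ler_sum => s _; rewrite normcM normcX normcN normc1 expr1n mul1r normc_prod.
  by apply: ler_prod => b _; rewrite normc_ge0 mxE lexx.
(* Permutations are enlarged to all maps, so that the sum factors into a product of column sums. *)
apply: (@le_trans _ _ (\sum_(f : {ffun 'I_#|` J| -> 'I_#|` J|})
    \prod_b normc (edge_mx w J (f b) b))).
  pose G (f : {ffun 'I_#|` J| -> 'I_#|` J|}) := \prod_b normc (edge_mx w J (f b) b).
  have G0 f : 0 <= G f by apply: prodr_ge0 => b _; exact: normc_ge0.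
  have -> : \sum_(s : 'S_#|` J|) \prod_b normc (edge_mx w J (s b) b) =
      \sum_(f in [set val s | s : 'S_#|` J|]%SET) G f.
    rewrite big_imset /=; last by move=> s s' _ _; exact: val_inj.
    apply: eq_big => [s|s _]; first by rewrite inE.
    by apply: eq_bigr => b _; rewrite -pvalE.
  rewrite [leRHS](bigID (mem [set val s | s : 'S_#|` J|]%SET)) /=.
  by rewrite lerDl; apply: sumr_ge0 => f _; exact: G0.
(* The column of e has at most M nonzero entries, all equal to w e. *)
rewrite -(bigA_distr_bigA (fun b a => normc (edge_mx w J a b))) -prod_edge_nth.
apply: ler_prod => b _; rewrite sumr_ge0/=; last by move=> a _; exact: normc_ge0.
rewrite (eq_bigr (fun a => if arrow (edge_nth a) (edge_nth b) then w (edge_nth b) else 0)); last first.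
  by move=> a _; rewrite mxE normcR ger0_norm//; case: ifP.
rewrite -big_mkcond sumr_const -[_ *+ _]mulr_natl ler_wpM2r// ler_nat.
rewrite cardE -(size_map (@edge_nth V X J)); apply: (@indegree_le M (orig (edge_nth b))) => //.
  by rewrite map_inj_uniq ?enum_uniq//; exact: edge_nth_inj.
by move=> _ /mapP[a + ->]; rewrite mem_enum => /andP[/eqP ->].
Qed.

Definition subfset (F : {fset E}) (S : {set 'I_#|` F|}) : {fset E} :=
  [fset edge_nth a | a in S]%fset.

Lemma subfset_sub (F : {fset E}) S : (@subfset F S `<=` F)%fset.
Proof. by apply/fsubsetP => _ /imfsetP[a _ ->]; apply/edge_nthP; exists a. Qed.

Lemma mem_subfset (F : {fset E}) S a : (edge_nth a \in @subfset F S) = (a \in S).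
Proof.
apply/imfsetP/idP => [[b bS /edge_nth_inj ->]//|aS]; by exists a.
Qed.

Lemma card_subfset (F : {fset E}) S : #|` @subfset F S| = #|S|.
Proof. by rewrite card_imfset /= ?cardE//; exact: edge_nth_inj. Qed.

Lemma subfset_inj (F : {fset E}) : injective (@subfset F).
Proof. by move=> S S' SS'; apply/setP => a; rewrite -!mem_subfset SS'. Qed.

Lemma subfset_surj (F J : {fset E}) : (J `<=` F)%fset -> exists S, J = @subfset F S.
Proof.
move=> /fsubsetP JF; exists [set a | edge_nth a \in J]%SET.
apply/fsetP => e; apply/idP/imfsetP => [eJ|[a + ->]]; last by rewrite /= inE.
by have /edge_nthP[a ea] := JF _ eJ; exists a => //=; rewrite inE -ea.
Qed.

(** The enumerations of [F] and of the subset are unrelated; [f] locates the second in the first and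
    acts on rows and columns alike, so no sign appears. *)
Lemma pminor_subfset (F : {fset E}) S :
  pminor (edge_mx w F) S = \det (edge_mx w (@subfset F S)).
Proof.
have idx a : exists b, @edge_nth V X F b = edge_nth (a : 'I_#|` subfset S|).
  have /edge_nthP[b bE] : edge_nth a \in F.
    apply: (fsubsetP (subfset_sub S)); by apply/edge_nthP; exists a.
  by exists b.
have [f fE] := choice idx.
have fI : injective f.
  by move=> a b ab; apply: (@edge_nth_inj (subfset S)); rewrite -!fE ab.
have -> : S = [set f a | a : 'I_#|` subfset S|]%SET.
  apply/setP => b; apply/idP/imsetP => [bS|[a _ ->]].
    have : edge_nth b \in subfset S by rewrite mem_subfset.
    by move=> /edge_nthP[a ba]; exists a => //; apply: edge_nth_inj; rewrite fE.
  by rewrite -mem_subfset fE; apply/edge_nthP; exists a.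
have SE : [set f a | a : 'I_#|` subfset S|]%SET = S.
  apply/setP => b; apply/imsetP/idP => [[a _ ->]|bS].
    by rewrite -mem_subfset fE; apply/edge_nthP; exists a.
  have : edge_nth b \in subfset S by rewrite mem_subfset.
  by move=> /edge_nthP[a ba]; exists a => //; apply: edge_nth_inj; rewrite fE.
rewrite (pminor_enum _ fI) SE; congr (\det _).
by apply/matrixP => a b; rewrite !mxE !fE.
Qed.

Lemma sum_subfset (T : zmodType) (F : {fset E}) (g : {fset E} -> T) :
  \sum_(J <- fpowerset F) g J = \sum_(S : {set 'I_#|` F|}) g (subfset S).
Proof.
rewrite -[RHS](big_map (@subfset F) xpredT g); apply: perm_big.
apply: uniq_perm => [||J]; first exact: fset_uniq.
  by rewrite map_inj_uniq ?index_enum_uniq//; exact: subfset_inj.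
apply/idP/mapP => [|[S _ ->]].
  rewrite fpowersetE => /subfset_surj[S ->].
  by exists S => //; rewrite mem_index_enum.
by rewrite fpowersetE subfset_sub.
Qed.

(** The sum over subsets is the product of the factors [1 + x * w e], each at most
    [expR (x * w e)]. *)
Lemma sum_prod_fpowerset_le (F : {fset E}) (x : R) : 0 <= x ->
  \sum_(J <- fpowerset F) \prod_(e <- J) (x * w e) <= expR (x * \sum_(e <- F) w e).
Proof.
move=> x0; rewrite sum_subfset.
rewrite (eq_bigr (fun S : {set 'I_#|` F|} =>
   \prod_a (if a \in S then x * w (edge_nth a) else 1))); last first.
  move=> S _; rewrite -big_mkcond /= big_imfset /=; last by move=> a b _ _ /edge_nth_inj.
  by rewrite big_enum_cond /=; apply: eq_bigl => a; rewrite ?andbT.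
rewrite -(bigA_distr _ _ (fun a => x * w (edge_nth a)) (fun=> 1)) /=.
rewrite (big_tnth _ _ (enum_fset F)) mulr_sumr expR_sum.
apply: ler_prod => a _; rewrite addr_ge0 ?mulr_ge0//= addrC expR_ge1Dx//.
Qed.

End Minors.

Lemma big_pmap_insub (S : Type) (idx : S) (op : Monoid.law idx) (T : Type)
    (P : pred T) (sT : subType P) (s : seq T) (g : T -> S) :
  \big[op/idx]_(J <- pmap (insub : T -> option sT) s) g (val J) =
  \big[op/idx]_(J <- s | P J) g J.
Proof.
elim: s => [|x s IH] /=; first by rewrite !big_nil.
rewrite big_cons -IH; case: insubP => [y -> yx|/negPf ->] //=.
by rewrite big_cons yx.
Qed.

(** * Newton's identities under limits and bounds *)

Section NewtonLimit.
Variable R : realType.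
Local Notation C := R[i].

Lemma newton_cvg (J : choiceType) (q p : {fset J} -> nat -> C) (a b : nat -> C) :
  (forall A, q A 0%N = 1) -> a 0%N = 1 ->
  (forall A n, q A n *+ n = - \sum_(i < n) p A i.+1 * q A (n - i.+1)%N) ->
  (forall n, a n *+ n = - \sum_(i < n) b i.+1 * a (n - i.+1)%N) ->
  (forall i, (fun A => p A i.+1) @ totally --> b i.+1) ->
  forall n, (fun A => q A n) @ totally --> a n.
Proof.
move=> q0 a0 hq ha pb; elim/ltn_ind => -[_|n IH].
  rewrite a0 [X in X @ _](_ : _ = fun=> 1); first exact: cvg_cst.
  by apply/funext.
have n0 : n.+1%:R != 0 :> C by rewrite pnatr_eq0.
have rec (x y : C) : x *+ n.+1 = - y -> x = - (n.+1%:R)^-1 * y.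
  move=> xy; apply: (mulfI n0); rewrite mulr_natl xy mulrA mulrN divff//.
  by rewrite mulN1r.
rewrite (rec _ _ (ha _)) [X in X @ _](_ : _ = fun A =>
    - (n.+1%:R)^-1 * \sum_(i < n.+1) p A i.+1 * q A (n.+1 - i.+1)%N); last first.
  by apply/funext => A; exact: rec (hq A n.+1).
apply: cvgCM; first exact: cvg_cst.
apply: cvgC_sum => i; apply: cvgCM; first exact: pb.
by apply: IH; rewrite subSS ltnS leq_subr.
Qed.

(** The recursion for [n] has [n] terms, each at most [W^n] by induction; the factor [n] on the left
    absorbs their number. *)
Lemma newton_le (q p : nat -> C) (W : R) : 0 <= W -> q 0%N = 1 ->
  (forall n, q n *+ n = - \sum_(i < n) p i.+1 * q (n - i.+1)%N) ->
  (forall i, normc (p i.+1) <= W ^+ i.+1) ->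
  forall n, normc (q n) <= W ^+ n.
Proof.
move=> W0 q0 hq pW; elim/ltn_ind => -[_|n IH]; first by rewrite q0 normc1.
have n0 : 0 < n.+1%:R :> R by rewrite ltr0n.
rewrite -(ler_pM2l n0).
have -> : n.+1%:R * normc (q n.+1) = normc (q n.+1 *+ n.+1).
  by rewrite normcMn mulr_natl.
rewrite hq normcN; apply: le_trans (normc_sum _ _ _) _.
apply: (@le_trans _ _ (\sum_(i < n.+1) W ^+ n.+1)).
  apply: ler_sum => i _.
  have -> : W ^+ n.+1 = W ^+ i.+1 * W ^+ (n.+1 - i.+1) by rewrite -exprD subnKC.
  rewrite normcM.
  by apply: ler_pM; rewrite ?normc_ge0 ?pW// IH// subSS ltnS leq_subr.
by rewrite sumr_const card_ord mulr_natl.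
Qed.

End NewtonLimit.

Section Coefficients.
Variables (R : realType) (V : choiceType) (X : sgraph V) (w : OE X -> R).
Local Notation E := (OE X).
Local Notation C := R[i].
Hypothesis w_ge0 : forall e, 0 <= w e.
Variable W : R.
Hypothesis wW : forall F : {fset E}, \sum_(e <- F) w e <= W.
Variable M : nat.
Hypothesis valM : forall x, ([set y | X x y] #<= `I_M)%card.

Definition minor_at (k : nat) (J : ksubset E k) : C := \det (edge_mx w (val J)).

(** The factor [rho^k] is distributed over the [k] edges of each minor, which replaces [M] by
    [rho * M] in the column bound; the family then lies in the power set of one finite set [F]. *)
Lemma sum_minors_le (k : nat) (rho : R) (A : {fset ksubset E k}) : 0 < rho ->
  \sum_(J <- A) normc (minor_at J) <= expR (rho * M%:R * W) / rho ^+ k.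
Proof.
move=> rho0; rewrite ler_pdivlMr ?exprn_gt0// mulr_suml.
pose g (J : {fset E}) := \prod_(e <- J) (rho * M%:R * w e).
have rM : 0 <= rho * M%:R by rewrite mulr_ge0// ltW.
have g0 J : 0 <= g J by apply: prodr_ge0 => e _; rewrite mulr_ge0.
apply: (@le_trans _ _ (\sum_(J <- A) g (val J))).
  apply: ler_sum => J _; rewrite /g mulrC.
  have -> : \prod_(e <- val J) (rho * M%:R * w e) =
      rho ^+ k * \prod_(e <- val J) (M%:R * w e).
    under eq_bigr do rewrite -mulrA.
    by rewrite big_split /= big_const_seq count_predT (eqP (valP J)) iter_mulr_1.
  apply: ler_wpM2l; first exact/exprn_ge0/ltW.
  exact: det_edge_mx_le valM _.
pose F := [fset e in flatten [seq enum_fset (val J) | J <- A]]%fset.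
rewrite -(big_map val xpredT g) (perm_big [fset J in map val A]%fset) /=; last first.
  apply: uniq_perm => [||J]; rewrite ?fset_uniq ?inE//.
  by rewrite map_inj_uniq ?fset_uniq//; exact: val_inj.
apply: (@le_trans _ _ (\sum_(J <- fpowerset F) g J)).
  apply: ler_sum_fsub => //; apply/fsubsetP => J; rewrite !inE => /mapP[J' J'A ->].
  rewrite fpowersetE; apply/fsubsetP => e eJ; rewrite !inE.
  apply/flattenP; exists (enum_fset (val J')); last exact: eJ.
  exact: (map_f (fun J : ksubset E k => enum_fset (val J)) J'A).
apply: le_trans (sum_prod_fpowerset_le w_ge0 _ rM) _.
by rewrite ler_expR ler_wpM2l.
Qed.

Definition minor_sum (k : nat) : C := unordered_sum (@minor_at k).

Lemma minor_sumP k : sum_converges (@minor_at k) (minor_sum k).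
Proof.
have [s hs] := sum_converges_abs (fun A => sum_minors_le (k := k) A ltr01).
by rewrite /minor_sum (unordered_sumE hs).
Qed.

Lemma minor_sum_le k (rho : R) : 0 < rho ->
  normc (minor_sum k) <= expR (rho * M%:R * W) / rho ^+ k.
Proof.
move=> rho0; apply: (cvg_totally_le (@minor_sumP k)) => A; rewrite partial_sumE.
by apply: le_trans (normc_sum _ _ _) _; exact: sum_minors_le.
Qed.

Definition det_coef (k : nat) : C := (-1) ^+ k * minor_sum k.

Lemma det_coef_psbound (rho : R) : 0 < rho ->
  psbound det_coef (expR (rho * M%:R * W)) rho.
Proof.
move=> rho0 k; rewrite /det_coef normcM normcX normcN normc1 expr1n mul1r.
by rewrite -ler_pdivlMr ?exprn_gt0//; exact: minor_sum_le.
Qed.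

Definition ksubsets_of (k : nat) (F : {fset E}) : seq (ksubset E k) :=
  pmap insub (fpowerset F).

Lemma charseries_edge_mx (F : {fset E}) (k : nat) :
  (charseries (edge_mx w F))`_k =
  (-1) ^+ k * \sum_(J <- ksubsets_of k F) minor_at J.
Proof.
rewrite coef_charseries; congr (_ * _).
rewrite (big_pmap_insub _ _ _ (fun J : {fset E} => \det (edge_mx w J))).
rewrite [RHS]big_mkcond /= sum_subfset [LHS]big_mkcond /=.
by apply: eq_bigr => S _; rewrite -(card_subfset S) pminor_subfset.
Qed.

Lemma charseries_cvg k :
  (fun F => (charseries (edge_mx w F))`_k) @ totally --> det_coef k.
Proof.
rewrite [X in X @ _](_ : _ = fun F : {fset E} => (-1) ^+ k *
    \sum_(J <- ksubsets_of k F) minor_at J); last first.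
  by apply/funext => F; rewrite charseries_edge_mx.
apply: cvgCM; first exact: cvg_cst.
apply: (sum_converges_cofinal (@minor_sumP k)) => [F|A0].
  by apply: pmap_sub_uniq; exact: fset_uniq.
exists [fset e in flatten [seq enum_fset (val J) | J <- A0]]%fset => F hF J JA _.
rewrite mem_pmap_sub fpowersetE; apply: fsubset_trans hF.
apply/fsubsetP => e eJ; rewrite !inE.
apply/flattenP; exists (enum_fset (val J)); last exact: eJ.
exact: (map_f (fun J : ksubset E k => enum_fset (val J)) JA).
Qed.

Definition walk_sum (i : nat) : C :=
  unordered_sum (fun t => (walk_weight w i t)%:C).

Lemma walk_sumP i : sum_converges (fun t => (walk_weight w i t)%:C) (walk_sum i).
Proof.
have [s [hs _ _]] := nneg_sum_converges (walk_weight_ge0 w_ge0 i)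
  (fun A => walk_weight_sum_le w_ge0 A i wW).
by rewrite /walk_sum (unordered_sumE hs).
Qed.

Lemma trace_cvg i :
  (fun F => \tr (edge_mx w F ^+ i.+1)) @ totally --> walk_sum i.+1.
Proof.
rewrite [X in X @ _](_ : _ = fun F : {fset E} =>
    \sum_(t <- words F i.+1) (walk_weight w i.+1 t)%:C); last first.
  by apply/funext => F; rewrite trace_edge_mx.
apply: (sum_converges_cofinal (@walk_sumP i.+1)) => [F|A0].
  exact/words_uniq/fset_uniq.
have [F0 hF0] := words_cover A0 i.+1; exists F0 => F /fsubsetP F0F t tA tn.
have st : size t == i.+1.
  by apply: contraNT tn => /negPf st; rewrite /walk_weight st.
have := hF0 _ tA st; rewrite !mem_words st /= => /allP h.
by apply/allP => e /h; exact: F0F.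
Qed.

Lemma det_coef0 : det_coef 0 = 1.
Proof.
apply: (cvg_totally_unique (@charseries_cvg 0)).
rewrite [X in X @ _](_ : _ = fun=> 1); first exact: cvg_cst.
apply/funext => F; rewrite coef_charseries expr0 mul1r.
rewrite (eq_bigl (pred1 (@finset.set0 _))); last by move=> S; rewrite cards_eq0.
rewrite big_pred1_eq /pminor [X in \det X](_ : _ = 1%:M) ?det1//.
by apply/matrixP => i j; rewrite !mxE inE.
Qed.

Lemma det_coef_newton n :
  det_coef n *+ n = - \sum_(i < n) walk_sum i.+1 * det_coef (n - i.+1)%N.
Proof.
have HE (F : {fset E}) : (charseries (edge_mx w F))`_n *+ n =
    - \sum_(i < n) \tr (edge_mx w F ^+ i.+1) * (charseries (edge_mx w F))`_(n - i.+1).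
  exact: newtonP (@newton_charseries _ n _ _) (leqnn n).
apply: (@cvg_totally_unique _ _ (fun F => (charseries (edge_mx w F))`_n *+ n)).
  rewrite -mulr_natl [X in X @ _](_ : _ = fun F : {fset E} => n%:R * (charseries (edge_mx w F))`_n).
    by apply: cvgCM; [exact: cvg_cst|exact: charseries_cvg].
  by apply/funext => F; rewrite mulr_natl.
rewrite -mulN1r [X in X @ _](_ : _ = fun F : {fset E} => -1 *
   \sum_(i < n) \tr (edge_mx w F ^+ i.+1) * (charseries (edge_mx w F))`_(n - i.+1)).
  apply: cvgCM; first exact: cvg_cst.
  apply: cvgC_sum => i; apply: cvgCM; [exact: trace_cvg|exact: charseries_cvg].
by apply/funext => F; rewrite HE mulN1r.
Qed.

Section Euler.
Local Notation primes := (@regular_primes V X).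

Definition euler_poly (A : {fset primes}) : {poly C} :=
  \prod_(c <- A) (1 - (cycle_weight w (val c))%:C *: 'X^(cycle_length (val c))).

Definition prime_power_sum (A : {fset primes}) (i : nat) : C :=
  \sum_(c <- A) ((cycle_length (val c))%:R *
     (cycle_weight w (val c))%:C ^+ (i %/ cycle_length (val c))%N) *+
       (cycle_length (val c) %| i)%N.

Lemma cycle_length_gt0 (c : primes) : (0 < cycle_length (val c))%N.
Proof.
rewrite cycle_length_edges lt0n size_eq0.
by have [] := prime_wordP c.
Qed.

Lemma euler_poly_newton A n : (euler_poly A)`_n *+ n =
  - \sum_(i < n) prime_power_sum A i.+1 * (euler_poly A)`_(n - i.+1).
Proof.
apply: newtonP (leqnn n); apply: newton_prod => c.
exact: newton_1subXn (cycle_length_gt0 c).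
Qed.

Lemma euler_poly0 A : (euler_poly A)`_0 = 1.
Proof.
rewrite -horner_coef0 /euler_poly horner_prod big1// => c _.
by rewrite !hornerE expr0n eqn0Ngt cycle_length_gt0 /= mulr0 subr0.
Qed.

Lemma prime_power_sum_cvg i :
  (fun A => prime_power_sum A i.+1) @ totally --> walk_sum i.+1.
Proof.
rewrite [X in X @ _](_ : _ = fun A : {fset primes} =>
    \sum_(t <- prime_walks A i.+1) (walk_weight w i.+1 t)%:C); last first.
  by apply/funext => A; rewrite sum_prime_walks.
apply: (sum_converges_cofinal (@walk_sumP i.+1)) => [A|A0].
  exact: prime_walks_uniq.
(* The prime is optional because a word of weight 0 need not come from one. *)
have cov t : exists o : option primes, walk_weight w i.+1 t != 0 ->
    exists2 c, o = Some c & forall A : {fset primes}, c \in A -> t \in prime_walks A i.+1.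
  have [t0|t0] := eqVneq (walk_weight w i.+1 t) 0; first by exists None.
  by have [c hc] := prime_walks_cover (ltn0Sn i) t0; exists (Some c) => _; exists c.
have [sel selP] := choice cov.
exists [fset c in pmap sel A0]%fset => A /fsubsetP hA t tA tn.
have [|c oc] := selP t; first by apply: contraNN tn => /eqP ->.
by apply; apply: hA; rewrite !inE mem_pmap -oc; exact: map_f tA.
Qed.

(** The walks above the primes in [A] are distinct words, so the bound for all words applies
    uniformly in [A]. *)
Lemma prime_power_sum_le A i : normc (prime_power_sum A i.+1) <= W ^+ i.+1.
Proof.
rewrite /prime_power_sum -sum_prime_walks//.
apply: le_trans (normc_sum _ _ _) _.
pose B := [fset t in prime_walks A i.+1]%fset.
rewrite (perm_big B); last first.
  apply: uniq_perm => [||t]; [exact: prime_walks_uniq|exact: fset_uniq|].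
  by rewrite !inE.
apply: le_trans (walk_weight_sum_le w_ge0 B i.+1 wW).
apply: ler_sum => t _; rewrite normcR ger0_norm//; exact: walk_weight_ge0.
Qed.

Lemma W_ge0 : 0 <= W.
Proof. by have := wW fset0; rewrite big_seq_fset0. Qed.

Lemma walk_sum_le i : normc (walk_sum i) <= W ^+ i.
Proof.
apply: (cvg_totally_le (@walk_sumP i)) => A; rewrite partial_sumE.
apply: le_trans (normc_sum _ _ _) _.
apply: le_trans (walk_weight_sum_le w_ge0 A i wW).
by apply: ler_sum => t _; rewrite normcR ger0_norm//; exact: walk_weight_ge0.
Qed.

(** The coefficients are bounded by [W^n]; taking [W + 1] gives a positive radius even for
    [W = 0]. *)
Lemma newton_psbound (q p : nat -> C) : q 0%N = 1 ->
  (forall n, q n *+ n = - \sum_(i < n) p i.+1 * q (n - i.+1)%N) ->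
  (forall i, normc (p i.+1) <= W ^+ i.+1) -> psbound q 1 (W + 1)^-1.
Proof.
move=> q0 hq pW n; have W1 : 0 < W + 1 by rewrite ltr_wpDl ?W_ge0.
rewrite exprVn ler_pdivrMr ?exprn_gt0// mul1r.
have := newton_le W_ge0 q0 hq pW n.
move/le_trans; apply; rewrite lerXn2r ?nnegrE ?W_ge0 ?(ltW W1)//.
by rewrite lerDl.
Qed.

Lemma euler_poly_cvg n : (fun A => (euler_poly A)`_n) @ totally --> det_coef n.
Proof.
exact: (newton_cvg euler_poly0 det_coef0 euler_poly_newton det_coef_newton prime_power_sum_cvg).
Qed.

Lemma euler_product_cvg (u : C) : normc u < (W + 1)^-1 ->
  (fun A => (euler_poly A).[u]) @ totally --> psum det_coef u.
Proof.
have W1 : 0 < (W + 1)^-1 by rewrite invr_gt0 ltr_wpDl ?W_ge0.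
move=> ur; rewrite [X in X @ _](_ : _ = fun A : {fset primes} => psum (fun n => (euler_poly A)`_n) u).
  apply: (psum_dominated W1 _ _ euler_poly_cvg ur) => [A|].
    exact: newton_psbound (euler_poly0 A) (euler_poly_newton A) (prime_power_sum_le A).
  exact: newton_psbound det_coef0 det_coef_newton (fun i => walk_sum_le i.+1).
by apply/funext => A; rewrite psum_poly.
Qed.

End Euler.

End Coefficients.

(** * Operators on the Hilbert space *)

Section Esum.
Variables (R : realType) (I : choiceType).

Lemma esum_le_fset (g : I -> R) (B : R) :
  (forall A : {fset I}, \sum_(i <- A) g i <= B) ->
  (\esum_(i in [set: I]) (g i)%:E <= B%:E)%E.
Proof.
move=> gB; apply: ge_ereal_sup => _ [A [finA _] <-].
by rewrite fsbig_finite// sumEFin lee_fin; exact: gB.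
Qed.

Lemma fset_le_esum (g : I -> R) (A : {fset I}) :
  ((\sum_(i <- A) g i)%:E <= \esum_(i in [set: I]) (g i)%:E)%E.
Proof.
apply: ereal_sup_ubound; exists [set` A]; first by split.
by rewrite fsbig_finite// set_fsetK sumEFin.
Qed.

End Esum.

Section Ell2Theory.
Variables (R : realType) (I : choiceType).
Local Notation C := R[i].
Local Notation ell2 := (ell2 R I).
Implicit Types (f g : ell2).

Lemma l2norm_ge0 f : 0 <= l2norm f.
Proof. exact: sqrtr_ge0. Qed.

Lemma sqr_esumE f : sqr_esum f = (l2norm f ^+ 2)%:E.
Proof.
have fin : sqr_esum f \is a fin_num.
  by rewrite ge0_fin_numE ?sqr_esum_ge0//; have /asboolP := ell2P f.
by rewrite /l2norm sqr_sqrtr ?fine_ge0 ?sqr_esum_ge0// fineK.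
Qed.

Lemma sum_sqr_le_l2norm f (A : {fset I}) :
  \sum_(i <- A) normc (f i) ^+ 2 <= l2norm f ^+ 2.
Proof. by rewrite -lee_fin -sqr_esumE fset_le_esum. Qed.

Lemma normc_le_l2norm f i : normc (f i) <= l2norm f.
Proof.
rewrite -(@ler_pXn2r _ 2)// ?nnegrE ?normc_ge0 ?l2norm_ge0//.
by have := sum_sqr_le_l2norm f [fset i]%fset; rewrite big_seq_fset1.
Qed.

Lemma l2norm_le f (B : R) : 0 <= B ->
  (forall A : {fset I}, \sum_(i <- A) normc (f i) ^+ 2 <= B ^+ 2) -> l2norm f <= B.
Proof.
move=> B0 /esum_le_fset; rewrite -/(sqr_esum f) sqr_esumE lee_fin.
by rewrite ler_pXn2r// nnegrE l2norm_ge0.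
Qed.

Lemma sqr_summableP (f : I -> C) (B : R) :
  (forall A : {fset I}, \sum_(i <- A) normc (f i) ^+ 2 <= B) -> f \in @sqr_summable R I.
Proof. by move=> /esum_le_fset h; apply/asboolP; apply: le_lt_trans h (ltry _). Qed.

Lemma ell2_eq f g : (forall i, f i = g i) -> f = g.
Proof. by move=> fg; apply: val_inj; apply/funext. Qed.

Lemma ell2D f g i : (f + g) i = f i + g i. Proof. by []. Qed.
Lemma ell2N f i : (- f) i = - f i. Proof. by []. Qed.
Lemma ell2Z (a : C) f i : (a *: f) i = a * f i. Proof. by []. Qed.
Lemma ell20 i : (0 : ell2) i = 0. Proof. by []. Qed.

Lemma ell2_sum (T : Type) (s : seq T) (F : T -> ell2) i :
  (\sum_(t <- s) F t) i = \sum_(t <- s) F t i.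
Proof. by elim: s => [|t s IH]; rewrite ?big_nil ?ell20// !big_cons ell2D IH. Qed.

Lemma deltaE (i j : I) : delta R i j = (j == i)%:R. Proof. by []. Qed.

Lemma sum_delta (f : I -> C) (A : {fset I}) j :
  (\sum_(i <- A) f i *: delta R i) j = if j \in A then f j else 0.
Proof.
rewrite ell2_sum; case: ifPn => jA.
  rewrite (big_fsetD1 j jA) ell2Z deltaE eqxx mulr1 big_seq big1 => [|i]; first exact: addr0.
  by rewrite !inE ell2Z deltaE eq_sym => /andP[/negPf -> _]; rewrite mulr0.
rewrite big_seq big1// => i iA; rewrite ell2Z deltaE.
by case: eqP => [ji|_]; [rewrite ji iA in jA|rewrite mulr0].
Qed.

Lemma ell2_approx f (e : R) : 0 < e -> exists A : {fset I},
  l2norm (f - \sum_(i <- A) f i *: delta R i) <= e.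
Proof.
move=> e0; have sq0 i : 0 <= normc (f i) ^+ 2 by rewrite exprn_ge0 ?normc_ge0.
have [s [/cvg_totallyP fs _ sB]] := nneg_sum_converges sq0 (sum_sqr_le_l2norm f).
have [A hA] := fs _ (exprn_gt0 2 e0); exists A.
apply: l2norm_le (ltW e0) _ => B.
pose B' := (B `\` A)%fset.
apply: (@le_trans _ _ (\sum_(i <- B') normc (f i) ^+ 2)).
  rewrite (big_fsetID _ (mem A)) big_seq big1 ?[leLHS]add0r; last first.
    move=> i; rewrite !inE => /andP[_ iA].
    by rewrite ell2D ell2N sum_delta iA subrr normc0 expr0n.
  rewrite (_ : [fset x in B | x \notin A]%fset = B'); last first.
    by apply/fsetP => i; rewrite !inE /= andbC.
  rewrite big_seq [leRHS]big_seq; apply: ler_sum => i; rewrite !inE => /andP[/negPf iA _].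
  by rewrite ell2D ell2N sum_delta iA subr0.
have := hA A (fsubset_refl _); rewrite partial_sumE -rmorph_sum -rmorphB normcR.
rewrite distrC ger0_norm ?subr_ge0// => /ltW; apply: le_trans.
rewrite lerBrDr; apply: le_trans (sB (B' `|` A)%fset).
rewrite [leRHS](big_fsetID _ (mem A)).
have -> : [fset x in B' `|` A | mem A x]%fset = A.
  by apply/fsetP => i; rewrite !inE /=; case: (i \in A); rewrite ?orbT ?andbF.
have -> : [fset x in B' `|` A | ~~ mem A x]%fset = B'.
  by apply/fsetP => i; rewrite !inE /=; case: (i \in A); rewrite ?orbF ?andbT ?andbF.
by rewrite addrC.
Qed.

Lemma bounded_linear_ext (S T : {linear ell2 -> ell2}) :
  bounded_op S -> bounded_op T -> (forall i, S (delta R i) = T (delta R i)) -> S =1 T.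
Proof.
move=> [MS hS] [MT hT] ST f; apply: ell2_eq => j.
apply/eqP; rewrite -subr_eq0; apply/eqP; apply: normc_lt_eq0 => e e0.
(* The bounds [MS] and [MT] may be negative, hence the absolute values; the summand 1 keeps the
   denominator positive and makes the final estimate strict. *)
have K0 : 0 < `|MS| + `|MT| + 1 by rewrite ltr_wpDl ?addr_ge0.
have [A hA] := ell2_approx f (divr_gt0 e0 K0).
have [g [{}hA fE]] : exists g, l2norm g <= e / (`|MS| + `|MT| + 1) /\
    f = g + \sum_(i <- A) f i *: delta R i.
  by exists (f - \sum_(i <- A) f i *: delta R i); rewrite subrK.
have STA : S (\sum_(i <- A) f i *: delta R i) = T (\sum_(i <- A) f i *: delta R i).
  by rewrite !linear_sum; apply: eq_bigr => i _; rewrite !linearZ /= ST.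
rewrite fE (linearD S) (linearD T) STA !ell2D.
have ringE (L : zmodType) (x y z : L) : (x + z) - (y + z) = x - y.
  by rewrite opprD addrACA subrr addr0.
rewrite ringE; apply: le_lt_trans (le_normcD _ _) _; rewrite normcN.
have hS' : normc (S g j) <= `|MS| * l2norm g.
  apply: le_trans (normc_le_l2norm _ _) _; apply: le_trans (hS g) _.
  by rewrite ler_wpM2r ?l2norm_ge0 ?ler_norm.
have hT' : normc (T g j) <= `|MT| * l2norm g.
  apply: le_trans (normc_le_l2norm _ _) _; apply: le_trans (hT g) _.
  by rewrite ler_wpM2r ?l2norm_ge0 ?ler_norm.
apply: le_lt_trans (lerD hS' hT') _; rewrite -mulrDl.
apply: (@le_lt_trans _ _ ((`|MS| + `|MT|) * (e / (`|MS| + `|MT| + 1)))).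
  by rewrite ler_wpM2l ?addr_ge0.
rewrite mulrA ltr_pdivrMr// mulrC ltr_pM2l//.
by rewrite ltrDl.
Qed.

Lemma inner_fin (f g : I -> C) (A : {fset I}) :
  (forall i, i \notin A -> g i = 0) -> inner f g = \sum_(i <- A) f i * (g i)^*.
Proof.
move=> gA; apply: unordered_sumE; apply: sum_converges_fin => i /gA ->.
by rewrite [X in _ * X]conjc0 mulr0.
Qed.

Lemma inner_delta (f : I -> C) i : inner f (delta R i) = f i.
Proof.
rewrite (inner_fin f (A := [fset i]%fset)).
  by rewrite big_seq_fset1 deltaE eqxx [X in _ * X]conjc1 mulr1.
by move=> j; rewrite inE deltaE => /negPf ->.
Qed.

(* Operators whose matrix has finitely many nonzero entries in each row and
   summable row sums. *)
Record row_kernel := RowKernel {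
  rk_dom : I -> {fset I};
  rk_fun : I -> I -> C;
  rk_bd : I -> R;
  rk_tot : R;
  rk_row : forall b, \sum_(a <- rk_dom b) normc (rk_fun b a) <= rk_bd b;
  rk_sum : forall A : {fset I}, \sum_(b <- A) rk_bd b <= rk_tot }.

Section RowOperator.
Variable k : row_kernel.

Definition row_apply (f : I -> C) (b : I) : C :=
  \sum_(a <- rk_dom k b) rk_fun k b a * f a.

Lemma rk_bd_ge0 b : 0 <= rk_bd k b.
Proof. by apply: le_trans (rk_row k b); apply: sumr_ge0 => a _; exact: normc_ge0. Qed.

Lemma rk_tot_ge0 : 0 <= rk_tot k.
Proof. by have := rk_sum k fset0; rewrite big_seq_fset0. Qed.

Lemma row_apply_le (f : ell2) b : normc (row_apply f b) <= rk_bd k b * l2norm f.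
Proof.
apply: le_trans (normc_sum _ _ _) _.
apply: le_trans (ler_wpM2r (l2norm_ge0 f) (rk_row k b)).
rewrite mulr_suml; apply: ler_sum => a _; rewrite normcM.
by rewrite ler_wpM2l ?normc_ge0 ?normc_le_l2norm.
Qed.

(** Each row bound is at most the total, so summable bounds are square summable; with
    [normc (f a) <= l2norm f] this bounds the operator. *)
Lemma sum_sqr_rk_bd (A : {fset I}) : \sum_(b <- A) rk_bd k b ^+ 2 <= rk_tot k ^+ 2.
Proof.
have bd b : rk_bd k b <= rk_tot k.
  by have := rk_sum k [fset b]%fset; rewrite big_seq_fset1.
apply: (@le_trans _ _ (\sum_(b <- A) rk_tot k * rk_bd k b)).
  by apply: ler_sum => b _; rewrite expr2 ler_wpM2r ?rk_bd_ge0.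
by rewrite -mulr_sumr expr2 ler_wpM2l ?rk_tot_ge0 ?rk_sum.
Qed.

Lemma sum_sqr_row_apply (f : ell2) (A : {fset I}) :
  \sum_(b <- A) normc (row_apply f b) ^+ 2 <= (rk_tot k * l2norm f) ^+ 2.
Proof.
rewrite exprMn; apply: le_trans (ler_wpM2r (sqr_ge0 (l2norm f)) (sum_sqr_rk_bd A)).
rewrite mulr_suml; apply: ler_sum => b _; rewrite -exprMn ler_pXn2r ?row_apply_le//.
  by rewrite nnegrE normc_ge0.
by rewrite nnegrE mulr_ge0 ?rk_bd_ge0 ?l2norm_ge0.
Qed.

Definition row_op (f : ell2) : ell2 := Ell2 (sqr_summableP (sum_sqr_row_apply f)).

Lemma row_opE f b : row_op f b = \sum_(a <- rk_dom k b) rk_fun k b a * f a.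
Proof. by []. Qed.

Lemma row_op_linear : linear row_op.
Proof.
move=> a f g; apply: ell2_eq => b; rewrite ell2D ell2Z !row_opE mulr_sumr -big_split.
apply: eq_bigr => c _; rewrite ell2D ell2Z.
have ringE (L : comNzRingType) (x y z t : L) : x * (y * z + t) = y * (x * z) + x * t by ring.
exact: ringE.
Qed.

HB.instance Definition _ :=
  GRing.isLinear.Build C ell2 ell2 *:%R row_op row_op_linear.

Lemma row_op_bounded : bounded_op row_op.
Proof.
exists (rk_tot k) => f; apply: l2norm_le; last exact: sum_sqr_row_apply.
by rewrite mulr_ge0 ?rk_tot_ge0 ?l2norm_ge0.
Qed.

Lemma row_op_delta e b :
  row_op (delta R e) b = if e \in rk_dom k b then rk_fun k b e else 0.
Proof.
rewrite row_opE; case: ifPn => eb.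
  rewrite (big_fsetD1 e eb) deltaE eqxx mulr1 big_seq big1 => [|a]; first exact: addr0.
  by rewrite !inE deltaE => /andP[/negPf -> _]; rewrite mulr0.
rewrite big_seq big1// => a ab; rewrite deltaE.
by case: eqP => [ae|_]; [rewrite -ae ab in eb|rewrite mulr0].
Qed.

End RowOperator.

End Ell2Theory.

Section Wedge.
Variables (R : realType) (I : choiceType).
Local Notation C := R[i].

(** Only rearrangements of [J] contribute: an entry outside [J] gives a zero column, a repeated
    entry two equal columns. Each of the [k!] rearrangements contributes [\det B / k!], since its
    sign enters twice and the two normalizing factors multiply to [1 / k!]. *)
Lemma wedge_diagE (S : ell2 R I -> ell2 R I) (k : nat) (J : ksubset I k) :
  wedge_diag S J = \det (\matrix_(a, b)
    S (delta R (tnth (ksubset_tuple J) a)) (tnth (ksubset_tuple J) b)).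
Proof.
set B := \matrix_(a, b) _; set t := ksubset_tuple J.
have tI : injective (tnth t) by apply/tuple_uniqP; exact: fset_uniq.
pose F (s : k.-tuple I) : C := \det (\matrix_(a, b) S (delta R (tnth t a)) (tnth s b)).
pose D (s : k.-tuple I) : C := \det (\matrix_(a, b) (tnth s b == tnth t a)%:R).
pose c : C := (Num.sqrt (k`!%:R : R))%:C^-1.
pose tup (f : {ffun 'I_k -> 'I_k}) : k.-tuple I := [tuple tnth t (f b) | b < k].
have tupI : injective tup.
  move=> f g fg; apply/ffunP => b; apply: tI.
  by have := congr1 (fun s => tnth s b) fg; rewrite !tnth_mktuple.
pose U := [fset tup f | f in [set: {ffun 'I_k -> 'I_k}]%SET]%fset.
have D0 s : s \notin U -> D s = 0.
  move=> sU; have [b hb] : exists b, forall a, tnth s b != tnth t a.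
    apply: contrapT => nb; move/negP: sU; apply.
    have all b : exists a, tnth s b = tnth t a.
      apply: contrapT => na; apply: nb; exists b => a; apply/eqP => ba.
      by apply: na; exists a.
    have [f fE] := choice all.
    apply/imfsetP; exists [ffun b => f b]; first by rewrite /= inE.
    by apply: eq_from_tnth => b; rewrite tnth_mktuple ffunE.
  rewrite /D (expand_det_col _ b) big1// => a _.
  by rewrite mxE (negPf (hb a)) mul0r.
rewrite /wedge_diag (inner_fin _ (A := U)); last first.
  by move=> s /D0 Ds; rewrite /wedge -/t [\det _]Ds mulr0.
rewrite big_imfset /=; last by move=> f g _ _; exact: tupI.
rewrite big_enum_cond /=.
transitivity (\sum_(s : 'S_k) c * F (tup (pval s)) * (c * D (tup (pval s)))^*).
  transitivity (\sum_(f : {ffun 'I_k -> 'I_k}) c * F (tup f) * (c * D (tup f))^*).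
    by apply: eq_bigl => f; rewrite !inE.
  rewrite (bigID (fun f : {ffun 'I_k -> 'I_k} => injectiveb f)) /= [X in _ + X]big1 ?addr0; last first.
    move=> f /injectivePn[b1 [b2 b12 fb]].
    have -> : D (tup f) = 0.
      rewrite /D -det_tr; apply: (determinant_alternate b12) => a.
      by rewrite !mxE !tnth_mktuple fb.
    by rewrite mulr0 [X in _ * X]conjc0 mulr0.
  rewrite (reindex (fun s : 'S_k => pval s)) /=; last first.
    pose in_Sk := insubd (1%g : 'S_k).
    by exists in_Sk => /= f Uf; [apply: val_inj; apply: insubdK|apply: insubdK].
  by apply: eq_bigl => s; exact: (valP s).
transitivity (\sum_(s : 'S_k) (k`!%:R)^-1 * \det B); last first.
  rewrite sumr_const card_Sn -[_ *+ _]mulr_natl [LHS]mulrA.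
  have k0 : (k`!%:R : C) != 0 by rewrite pnatr_eq0 -lt0n fact_gt0.
  by rewrite (divff k0) mul1r.
apply: eq_bigr => s _.
have -> : F (tup (pval s)) = (-1) ^+ s * \det B.
  transitivity (\det (col_perm s B)).
    by congr (\det _); apply/matrixP => a b; rewrite !mxE tnth_mktuple pvalE.
  by rewrite col_permE det_mulmx det_perm odd_permV mulrC.
have -> : D (tup (pval s)) = (-1) ^+ s.
  rewrite -det_perm -det_tr; congr (\det _); apply/matrixP => a b.
  by rewrite !mxE tnth_mktuple (inj_eq tI) pvalE.
pose r : R := (Num.sqrt k`!%:R)^-1.
have cr : c = r%:C by rewrite /c /r fmorphV.
have cj : conjc (c * (-1) ^+ s) = c * (-1) ^+ s.
  by rewrite cr -[(-1) ^+ s](rmorph_sign (real_complex R)) -rmorphM conjc_real.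
have cc : c * c = (k`!%:R)^-1.
  rewrite cr -rmorphM -[r * r]expr2 exprVn sqr_sqrtr ?ler0n// fmorphV.
  by rewrite rmorph_nat.
have ss : (-1) ^+ s * (-1) ^+ s = 1 :> C by rewrite -expr2 sqrr_sign.
have ringE (L : comNzRingType) (x y z q : L) : x * x = q -> y * y = 1 ->
    x * (y * z) * (x * y) = q * z.
  move=> <- yy; rewrite -[RHS]mulr1 -[in RHS]yy; ring.
by rewrite [X in _ * X]cj; exact: ringE cc ss.
Qed.

End Wedge.

(** * The edge operator *)

Section EdgeOperator.
Variables (R : realType) (V : choiceType) (X : sgraph V) (w : OE X -> R).
Local Notation E := (OE X).
Local Notation C := R[i].
Hypothesis w_ge0 : forall e, 0 <= w e.
Variable W : R.
Hypothesis wW : forall F : {fset E}, \sum_(e <- F) w e <= W.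
Variable M : nat.
Hypothesis valM : forall x, ([set y | X x y] #<= `I_M)%card.

Lemma finite_edges (A : set E) (f : E -> V) (v : V) : {in A &, injective f} ->
  (forall e, A e -> X v (f e)) -> finite_set A.
Proof.
move=> fI Af; apply: card_le_finite (finite_II M).
apply: card_le_trans (valM v).
rewrite -(card_le_eql (inj_card_eq fI)); apply: subset_card_le.
by move=> _ [e Ae <-]; exact: Af.
Qed.

Lemma edge_eq (a b : E) : orig a = orig b -> targ a = targ b -> a = b.
Proof.
move=> o t; apply: val_inj; rewrite (surjective_pairing (val a)) (surjective_pairing (val b)).
by congr (_, _).
Qed.

Lemma finite_star v : finite_set [set a : E | targ a = v].
Proof.
apply: (@finite_edges _ (@orig V X) v) => [a b|a].
  by rewrite !inE /= => av bv ab; apply: edge_eq; rewrite // av bv.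
by move=> /= <-; rewrite adj_sym; exact: (valP a).
Qed.

Definition star v : {fset E} := fset_set [set a : E | targ a = v].

Lemma mem_star v a : (a \in star v) = (targ a == v).
Proof.
rewrite in_fset_set; last exact: finite_star.
by apply/idP/eqP => [/set_mem//|av]; apply/mem_set.
Qed.

Lemma size_star v : (size (star v) <= M)%N.
Proof.
apply: (indegree_le valM (v := v)); first exact: fset_uniq.
by move=> a; rewrite -[_ \in _]/(a \in star v) mem_star => /eqP.
Qed.

(** Only edges ending at the origin of [b] can precede it: at most [M] entries, each 0 or [w b]. *)
Lemma edge_row b :
  \sum_(a <- star (orig b)) normc ((if arrow a b then w b else 0)%:C : C) <= M%:R * w b.
Proof.
apply: (@le_trans _ _ (\sum_(a <- star (orig b)) w b)).
  by apply: ler_sum => a _; rewrite normcR ger0_norm; case: ifP.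
rewrite big_const_seq count_predT iter_addr_0 -[_ *+ _]mulr_natl.
by rewrite ler_wpM2r// ler_nat size_star.
Qed.

Lemma edge_row_sum (A : {fset E}) : \sum_(b <- A) M%:R * w b <= M%:R * W.
Proof. by rewrite -mulr_sumr ler_wpM2l. Qed.

Definition edge_kernel := RowKernel edge_row edge_row_sum.

Definition edge_op : {linear ell2 R E -> ell2 R E} := row_op edge_kernel.

Lemma edge_op_delta e b : edge_op (delta R e) b = (if arrow e b then w b else 0)%:C.
Proof.
rewrite row_op_delta /= mem_star; case: (boolP (arrow e b)) => [/andP[/eqP -> _]|_].
  by rewrite eqxx.
by case: ifP.
Qed.

Lemma edge_op_is_edge_operator : is_edge_operator w edge_op.
Proof.
split; first exact: row_op_bounded.
move=> e; set D := [set e' : E | _].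
have finD : finite_set D.
  apply: (@finite_edges _ (@targ V X) (targ e)) => [a b|a [ae _]].
    rewrite !inE /= => -[ae _] [be _] ab.
    by apply: edge_eq; rewrite // ae be.
  by rewrite -ae; exact: (valP a).
apply: ell2_eq => b; rewrite edge_op_delta fsbig_finite// sum_delta in_fset_set//.
rewrite (_ : b \in D = arrow e b); first by case: ifP.
apply/idP/andP => [/set_mem[/= be br]|[/eqP be /eqP br]].
  by split; apply/eqP.
exact/mem_set.
Qed.

Lemma edge_operator_unique (S T : {linear ell2 R E -> ell2 R E}) :
  is_edge_operator w S -> is_edge_operator w T -> S =1 T.
Proof.
move=> [bS dS] [bT dT]; apply: bounded_linear_ext => // e.
by rewrite dS dT.
Qed.

Lemma wedge_diag_edge_op (u : C) (k : nat) (J : ksubset E k) :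
  wedge_diag (fun f => u *: edge_op f) J = u ^+ k * \det (edge_mx w (val J)).
Proof.
rewrite wedge_diagE; case: J => J0 J0k; have E0 := eqP J0k; subst k.
rewrite -detZ; congr (\det _); apply/matrixP => a b; rewrite !mxE ell2Z edge_op_delta.
have tE c : tnth (ksubset_tuple (exist _ J0 J0k)) c = edge_nth c.
  rewrite /edge_nth (tnth_nth (edge_nth c)) [RHS](tnth_nth (edge_nth c)).
  by [].
by rewrite !tE.
Qed.

End EdgeOperator.

(** * The absolute value of the edge operator *)

Section InnerSum.
Variables (R : realType) (I : choiceType).
Local Notation C := R[i].

Lemma innerP (f g : ell2 R I) : sum_converges (fun i => f i * (g i)^*) (inner f g).
Proof.
have [|s hs] := @sum_converges_abs R I (fun i => f i * (g i)^*) (l2norm f ^+ 2 + l2norm g ^+ 2).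
  move=> A; apply: (@le_trans _ _ (\sum_(i <- A) (normc (f i) ^+ 2 + normc (g i) ^+ 2))).
    apply: ler_sum => i _; rewrite normcM normc_conj.
    have := sqr_ge0 (normc (f i) - normc (g i)).
    have := sqr_ge0 (normc (f i)); have := sqr_ge0 (normc (g i)).
    by rewrite sqrrB -mulr_natl; lra.
  by rewrite big_split lerD ?sum_sqr_le_l2norm.
by rewrite /inner (unordered_sumE hs).
Qed.

End InnerSum.

Section AbsoluteValue.
Variables (R : realType) (V : choiceType) (X : sgraph V) (w : OE X -> R).
Local Notation E := (OE X).
Local Notation C := R[i].
Hypothesis w_ge0 : forall e, 0 <= w e.
Variable W : R.
Hypothesis wW : forall F : {fset E}, \sum_(e <- F) w e <= W.
Variable M : nat.
Hypothesis valM : forall x, ([set y | X x y] #<= `I_M)%card.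

Local Notation T := (edge_op w_ge0 wW valM).
Local Notation star := (@star V X).

Lemma finite_outs v : finite_set [set e : E | orig e = v].
Proof.
apply: (@finite_edges _ _ _ valM _ (@targ V X) v) => [a b|a].
  by rewrite !inE /= => av bv ab; apply: edge_eq; rewrite // av bv.
by move=> /= <-; exact: (valP a).
Qed.

Definition outs v : {fset E} := fset_set [set e : E | orig e = v].

Lemma mem_outs v e : (e \in outs v) = (orig e == v).
Proof.
rewrite in_fset_set; last exact: finite_outs.
by apply/idP/eqP => [/set_mem//|av]; apply/mem_set.
Qed.

Definition ker (a e : E) : R := if arrow a e then w e else 0.

Lemma ker_ge0 a e : 0 <= ker a e.
Proof. by rewrite /ker; case: ifP. Qed.

(** The [l^1] norm of the image of the edge [a] under [T]. It dominates row [a] of the absolute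
    value entrywise, and its total is at most [M W] because an edge is reached from at most [M]
    others. *)
Definition row_weight (a : E) : R := \sum_(e <- outs (targ a)) ker a e.

Lemma row_weight_ge0 a : 0 <= row_weight a.
Proof. by apply: sumr_ge0 => e _; exact: ker_ge0. Qed.

Lemma sum_row_weight (F : {fset E}) : \sum_(a <- F) row_weight a <= M%:R * W.
Proof.
pose G := [fset e in flatten [seq enum_fset (outs (targ a)) | a <- F]]%fset.
apply: (@le_trans _ _ (\sum_(a <- F) \sum_(e <- G) ker a e)).
  rewrite big_seq [leRHS]big_seq; apply: ler_sum => a aF.
  apply: ler_sum_fsub => [e|]; first exact: ker_ge0.
  apply/fsubsetP => e ea; rewrite !inE; apply/flattenP.
  exists (enum_fset (outs (targ a))); last exact: ea.
  exact: (map_f (fun a : E => enum_fset (outs (targ a))) aF).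
rewrite exchange_big /=; apply: (@le_trans _ _ (\sum_(e <- G) M%:R * w e)); last first.
  by rewrite -mulr_sumr ler_wpM2l.
apply: ler_sum => e _; rewrite /ker -big_mkcond -big_filter.
rewrite big_const_seq count_predT iter_addr_0 -[_ *+ _]mulr_natl.
rewrite ler_wpM2r// ler_nat; apply: (indegree_le valM (v := orig e)).
  by rewrite filter_uniq ?fset_uniq.
by move=> a; rewrite mem_filter => /andP[/andP[/eqP]].
Qed.

(** The entry of [T^* T] for [a] and [b] with a common target; for different targets the images have
    disjoint supports, which is the block structure. *)
Definition gram (a b : E) : C := \sum_(e <- outs (targ a)) (ker a e)%:C * (ker b e)%:C.

Lemma exists_block_sqrt (v : V) : exists K : E -> E -> C,
  [/\ forall a b, a \in star v -> b \in star v -> K b a = (K a b)^*,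
      forall a b, a \in star v -> b \in star v ->
        \sum_(c <- star v) K a c * K c b = gram a b &
      forall x : E -> C,
        0 <= \sum_(a <- star v) (\sum_(b <- star v) K a b * x b) * (x a)^*].
Proof.
pose n := #|` star v|; pose m := #|` outs v|.
pose ix := @edge_nth V X (star v); pose ox := @edge_nth V X (outs v).
pose B : 'M[C]_(n, m) := \matrix_(i, j) (ker (ix i) (ox j))%:C.
have [P [Padj PP Ppos]] := exists_sqrt_mx B.
(* [P] is indexed by positions in an enumeration; [K] transports it to edges, with value 0 outside
   the block. *)
pose K a b : C := \sum_i \sum_j ((ix i == a) && (ix j == b))%:R * P i j.
have KE i j : K (ix i) (ix j) = P i j.
  rewrite /K (bigD1 i)//= (bigD1 j)//= !eqxx mul1r big1 ?addr0; last first.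
    by move=> j' /negPf jj'; rewrite (inj_eq (@edge_nth_inj V X (star v))) jj' mul0r.
  rewrite big1 ?addr0// => i' /negPf ii'; rewrite big1// => j' _.
  by rewrite (inj_eq (@edge_nth_inj V X (star v))) ii' mul0r.
exists K; split.
- move=> _ _ /edge_nthP[i ->] /edge_nthP[j ->]; rewrite !KE.
  by rewrite -{1}Padj !mxE.
- move=> a b aS bS; move: (aS) bS => /edge_nthP[i ai] /edge_nthP[j ->].
  rewrite big_edge_nth ai.
  rewrite (eq_bigr (fun c => P i c * P c j)); last by move=> c _; rewrite -!KE.
  have := congr1 (fun A : 'M[C]_n => A i j) PP; rewrite !mxE => ->.
  rewrite /gram -ai; move: aS; rewrite (mem_star valM) => /eqP ->.
  rewrite big_edge_nth; apply: eq_bigr => e _; rewrite !mxE ai; congr (_ * _).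
  exact: conjc_real.
(* Positivity of [P] is stated for row vectors, so it is applied to the conjugate of [x]. *)
- move=> x; have := Ppos (\row_j (x (ix j))^*); rewrite mxE.
  rewrite (eq_bigr (fun j => \sum_i (x (ix i))^* * P i j * x (ix j))); last first.
    move=> j _; rewrite !mxE mulr_suml; apply: eq_bigr => i _; rewrite !mxE.
    by congr (_ * _); exact: conjcK.
  rewrite exchange_big /= [X in 0 <= X -> _](_ : _ =
    \sum_(a <- star v) (\sum_(b <- star v) K a b * x b) * (x a)^*)//.
  rewrite big_edge_nth; apply: eq_bigr => i _.
  rewrite big_edge_nth mulr_suml; apply: eq_bigr => j _; rewrite -/(ix i) -/(ix j) KE.
  have ringE (L : comNzRingType) (p q r : L) : p * q * r = q * r * p by ring.
  exact: ringE.
Qed.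

Definition block_sqrt : V -> E -> E -> C := projT1 (choice exists_block_sqrt).

Lemma block_sqrtP v : [/\
  forall a b, a \in star v -> b \in star v -> block_sqrt v b a = (block_sqrt v a b)^*,
  forall a b, a \in star v -> b \in star v ->
    \sum_(c <- star v) block_sqrt v a c * block_sqrt v c b = gram a b &
  forall x : E -> C,
    0 <= \sum_(a <- star v) (\sum_(b <- star v) block_sqrt v a b * x b) * (x a)^*].
Proof. exact: (projT2 (choice exists_block_sqrt) v). Qed.

(** The squared moduli in row [a] sum to [gram a a], a sum of squares of nonnegative numbers, which
    is at most the square of their sum. *)
Lemma block_sqrt_le a b : b \in star (targ a) ->
  normc (block_sqrt (targ a) a b) <= row_weight a.
Proof.
move=> bS; have aS : a \in star (targ a) by rewrite (mem_star valM).
have [Kc KK _] := block_sqrtP (targ a); set K := block_sqrt (targ a) in Kc KK *.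
rewrite -(@ler_pXn2r _ 2)// ?nnegrE ?normc_ge0 ?row_weight_ge0//.
apply: (@le_trans _ _ (\sum_(c <- star (targ a)) normc (K a c) ^+ 2)).
  rewrite (big_fsetD1 b bS) /= lerDl; apply: sumr_ge0 => c _.
  by rewrite exprn_ge0 ?normc_ge0.
apply: (@le_trans _ _ (\sum_(e <- outs (targ a)) ker a e ^+ 2)).
  rewrite -lecR !rmorph_sum /= le_eqVlt; apply/orP; left; apply/eqP.
  transitivity (gram a a).
    rewrite -KK// big_seq [RHS]big_seq; apply: eq_bigr => c cS.
    rewrite (Kc _ _ aS cS); exact/esym/mulc_conj.
  by apply: eq_bigr => e _; rewrite rmorphXn.
rewrite [leRHS]expr2 /row_weight mulr_suml big_seq [leRHS]big_seq.
apply: ler_sum => e eS; rewrite expr2 ler_wpM2l ?ker_ge0//.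
rewrite (big_fsetD1 e eS) /= lerDl; apply: sumr_ge0 => c _; exact: ker_ge0.
Qed.

Lemma abs_row a : \sum_(b <- star (targ a)) normc (block_sqrt (targ a) a b)
  <= M%:R * row_weight a.
Proof.
apply: (@le_trans _ _ (\sum_(b <- star (targ a)) row_weight a)).
  by rewrite big_seq [leRHS]big_seq; apply: ler_sum => b; exact: block_sqrt_le.
rewrite big_const_seq count_predT iter_addr_0 -[_ *+ _]mulr_natl.
by rewrite ler_wpM2r ?row_weight_ge0// ler_nat (size_star valM).
Qed.

Lemma abs_row_sum (F : {fset E}) :
  \sum_(a <- F) M%:R * row_weight a <= M%:R * (M%:R * W).
Proof. by rewrite -mulr_sumr ler_wpM2l// sum_row_weight. Qed.

Definition abs_op : {linear ell2 R E -> ell2 R E} :=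
  row_op (RowKernel abs_row abs_row_sum).

Lemma abs_opE (f : ell2 R E) a :
  abs_op f a = \sum_(b <- star (targ a)) block_sqrt (targ a) a b * f b.
Proof. by []. Qed.

Lemma edge_opE (f : ell2 R E) e :
  T f e = \sum_(a <- star (orig e)) (ker a e)%:C * f a.
Proof. by []. Qed.

(* T maps the block of the edges ending at v to the block of the edges starting
   at v, and P preserves the former; finite unions of full blocks are cofinal
   among the finite sets, so the inner products can be compared block by block. *)
Definition blocks (S : V -> {fset E}) (A : {fset V}) : seq E :=
  [seq a | v <- A, a <- S v].

Lemma blocks_cofinal (S : V -> {fset E}) (p : E -> V) (f : E -> C) (s : C) :
  (forall v a, (a \in S v) = (p a == v)) -> sum_converges f s ->
  (fun A => \sum_(v <- A) \sum_(a <- S v) f a) @ totally --> s.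
Proof.
move=> mS fs; have := @sum_converges_cofinal R E V f s (blocks S) fs.
rewrite [X in X @ _ --> s](_ : _ = fun A : {fset V} => \sum_(v <- A) \sum_(a <- S v) f a).
  apply=> [A|A0].
    apply: allpairs_uniq_dep; first exact: fset_uniq.
      by move=> v _; exact: fset_uniq.
    move=> _ _ /allpairsPdep[v [a [_ + ->]]] /allpairsPdep[v' [a' [_ + ->]]] /=.
    by rewrite -![_ \in enum_fset _]/(_ \in S _) !mS => /eqP <- /eqP <- ->.
  exists [fset p a | a in A0]%fset => A /fsubsetP hA a aA _.
  apply/allpairsPdep; exists (p a), a; split => //.
    by apply: hA; apply/imfsetP; exists a.
  by rewrite -[_ \in _]/(a \in S (p a)) mS.
by apply/funext => A; rewrite big_allpairs_dep.
Qed.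

Lemma abs_op_ge0 (f : ell2 R E) : 0 <= inner (abs_op f) f.
Proof.
have := blocks_cofinal (mem_star valM) (@innerP _ _ (abs_op f) f).
move=> /cvg_totally_ge0; apply=> A; exists A; first exact: fsubset_refl.
apply: sumr_ge0 => v _; have [_ _ Kpos] := block_sqrtP v.
have := Kpos f; rewrite big_seq [X in _ -> 0 <= X]big_seq.
rewrite [X in _ -> 0 <= X](eq_bigr (fun a =>
  (\sum_(b <- star v) block_sqrt v a b * f b) * (f a)^*))//.
by move=> a; rewrite (mem_star valM) => /eqP av; rewrite abs_opE av.
Qed.

(** At each vertex both sides reduce to the form of [gram]: the left after grouping edges by target,
    the right after grouping them by origin. One limit along finite sets of vertices therefore
    serves both. *)
Lemma abs_op_sqr (f g : ell2 R E) :
  inner (abs_op (abs_op f)) g = inner (T f) (T g).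
Proof.
have h1 := blocks_cofinal (mem_star valM) (@innerP _ _ (abs_op (abs_op f)) g).
have h2 := blocks_cofinal mem_outs (@innerP _ _ (T f) (T g)).
apply: cvg_totally_unique h1 _; move: h2.
rewrite [X in X @ _ --> _](_ : _ = fun A : {fset V} => \sum_(v <- A)
  \sum_(a <- star v) abs_op (abs_op f) a * (g a)^*)//.
apply/funext => A; apply: eq_bigr => v _.
have [_ KK _] := block_sqrtP v.
transitivity (\sum_(e <- outs v) \sum_(a <- star v) \sum_(b <- star v)
    (ker a e)%:C * (ker b e)%:C * f b * (g a)^*).
  rewrite big_seq [RHS]big_seq; apply: eq_bigr => e; rewrite mem_outs => /eqP ev.
  rewrite !edge_opE ev rmorph_sum mulr_sumr; apply: eq_bigr => a _.
  rewrite mulr_suml; apply: eq_bigr => b _.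
  have cE : conjc ((ker a e)%:C * g a) = (ker a e)%:C * (g a)^*.
    rewrite [LHS]rmorphM; congr (_ * _); exact: conjc_real.
  rewrite [X in _ * X = _]cE.
  have ringE (L : comNzRingType) (p q r s : L) : p * q * (r * s) = r * p * q * s by ring.
  exact: ringE.
rewrite exchange_big big_seq [RHS]big_seq; apply: eq_bigr => a aS.
have av : targ a = v by move: aS; rewrite (mem_star valM) => /eqP.
rewrite abs_opE av exchange_big.
transitivity ((\sum_(b <- star v) gram a b * f b) * (g a)^*).
  rewrite mulr_suml; apply: eq_bigr => b _; rewrite /gram av !mulr_suml.
  by apply: eq_bigr => e _.
congr (_ * _).
transitivity (\sum_(c <- star v) \sum_(b <- star v)
    block_sqrt v a c * (block_sqrt v c b * f b)).
  rewrite exchange_big /= big_seq [RHS]big_seq; apply: eq_bigr => b bS.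
  by rewrite -KK// mulr_suml; apply: eq_bigr => c _; rewrite mulrA.
rewrite big_seq [RHS]big_seq; apply: eq_bigr => c cS.
by move: cS; rewrite (mem_star valM) => /eqP cv; rewrite abs_opE cv mulr_sumr.
Qed.

Lemma edge_op_trace_class : trace_class T.
Proof.
split; first exact: row_op_bounded.
exists abs_op; first split.
- exact: row_op_bounded.
- exact: abs_op_ge0.
- exact: abs_op_sqr.
apply: le_lt_trans (ltry (M%:R * W)); apply: esum_le_fset => F.
apply: le_trans (sum_row_weight F); apply: ler_sum => a _.
rewrite inner_delta row_op_delta /=.
have aS : a \in star (targ a) by rewrite (mem_star valM).
rewrite aS; apply: le_trans (ler_norm _) _; apply: le_trans (le_normc_Re _) _.
exact: block_sqrt_le.
Qed.

End AbsoluteValue.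

(** * The zeta function *)

Section Entire.
Variables (R : realType) (c : nat -> R[i]).
Local Notation C := R[i].
Hypothesis c_entire : forall rho : R, 0 < rho -> exists B, psbound c B rho.
Local Notation D := (psum c).

Lemma entire_rho (z : C) : exists rho B : R, [/\ 0 < rho, psbound c B rho & normc z < rho].
Proof.
have r0 : 0 < normc z + 1 by rewrite ltr_wpDl ?normc_ge0.
by have [B cB] := c_entire r0; exists (normc z + 1), B; split=> //; rewrite ltrDl.
Qed.

Lemma entire_psum : entire D.
Proof.
by move=> z; have [rho [B [r0 cB zr]]] := entire_rho z; exact: derivable_psum cB zr.
Qed.

Lemma meromorphic_inv_psum : c 0%N != 0 ->
  meromorphic [set u | D u = 0] (fun u => (D u)^-1).
Proof.
move=> c0; have iso := psum_isolated_zeros c_entire c0; split=> [z|z /eqP Dz|z Dz K].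
- have [e e0 H] := iso z; apply: (near_dnbhs_normc e0) => y yz ye.
  by apply/eqP; exact: H.
- by apply: derivableV => //; exact: entire_psum.
have [rho [B [r0 cB zr]]] := entire_rho z.
have [L [e1 [L0 e10 lip]]] := psum_lipschitz r0 cB zr.
have [e2 e20 H] := iso z.
have K0 : 0 < `|K| + 1 by rewrite ltr_wpDl.
have e30 : 0 < (L * (`|K| + 1))^-1 by rewrite invr_gt0 mulr_gt0.
(* [e1] gives the Lipschitz bound, [e2] keeps [D y] nonzero, and the last radius forces
   [normc (D y) <= 1 / (|K| + 1)]. *)
have m0 : 0 < Num.min (Num.min e1 e2) (L * (`|K| + 1))^-1 by rewrite !lt_min e10 e20.
apply: (near_dnbhs_normc m0) => y yz; rewrite !lt_min => /andP[/andP[y1 y2] y3].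
have [_] := lip _ y1; rewrite Dz subr0 => hl.
have Dy : 0 < normc (D y) by rewrite normc_gt0; exact: H.
rewrite normcV; apply: le_lt_trans (ler_norm K) _.
apply: (@lt_le_trans _ _ (`|K| + 1)); first by rewrite ltrDl.
rewrite -[X in X <= _]invrK lef_pV2 ?posrE ?invr_gt0//.
apply: le_trans hl _; rewrite -ler_pdivlMl// -invfM; exact: ltW.
Qed.

End Entire.

Section Zeta.
Variables (R : realType) (V : choiceType) (X : sgraph V) (w : OE X -> R).
Local Notation E := (OE X).
Local Notation C := R[i].
Hypothesis w_ge0 : forall e, 0 <= w e.
Variable W : R.
Hypothesis wW : forall F : {fset E}, \sum_(e <- F) w e <= W.
Variable M : nat.
Hypothesis valM : forall x, ([set y | X x y] #<= `I_M)%card.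

Lemma cycle_weight_le (c : @regular_primes V X) :
  0 <= cycle_weight w (val c) <= W ^+ cycle_length (val c).
Proof.
rewrite cycle_weightE cycle_length_edges -/(prime_word c) prodw_ge0//=.
elim: (prime_word c) => [|e s IH]; first by rewrite big_nil.
rewrite big_cons exprS ler_pM ?prodw_ge0//.
by have := wW [fset e]%fset; rewrite big_seq_fset1.
Qed.

(** For a prime of length [l] the subtracted term has modulus at most [(W * normc u)^l], below 1 in
    this disc. *)
Lemma euler_factor_neq0 (u : C) (c : @regular_primes V X) : normc u < (W + 1)^-1 ->
  1 - (cycle_weight w (val c))%:C * u ^+ cycle_length (val c) != 0.
Proof.
have W0 := W_ge0 wW; have W1 : 0 < W + 1 by rewrite ltr_wpDl.
move=> ur; apply/eqP => /eqP; rewrite subr_eq0 => /eqP/(congr1 (@normc _)).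
have /andP[cw0 cwW] := cycle_weight_le c.
rewrite normc1 normcM normcX normcR ger0_norm// => /esym/eqP; apply/negP.
have l0 := cycle_length_gt0 c; rewrite lt_eqF//.
apply: (@le_lt_trans _ _ ((W * normc u) ^+ cycle_length (val c))).
  by rewrite exprMn ler_wpM2r ?exprn_ge0 ?normc_ge0.
rewrite exprn_ilt1 ?mulr_ge0 ?normc_ge0 -?lt0n//.
apply: (@le_lt_trans _ _ ((W + 1) * normc u)).
  by rewrite ler_wpM2r ?normc_ge0 ?lerDl.
by rewrite mulrC -ltr_pdivlMr// mul1r.
Qed.

Lemma euler_product_converges (u : C) : normc u < (W + 1)^-1 ->
  psum (det_coef w) u != 0 ->
  prod_converges (euler_factor w u) (psum (det_coef w) u)^-1.
Proof.
move=> ur Du; split.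
- by move=> c; rewrite invr_eq0 euler_factor_neq0.
- by rewrite invr_eq0.
have prodE (A : {fset @regular_primes V X}) :
    \prod_(i : A) euler_factor w u (val i) = ((euler_poly w A).[u])^-1.
  rewrite -(big_seq_fsetE _ _ xpredT (euler_factor w u)) /euler_poly horner_prod prodfV.
  by congr _^-1; apply: eq_bigr => c _; rewrite !hornerE.
under eq_cvg do rewrite prodE.
exact: cvgV Du (euler_product_cvg w_ge0 wW valM ur).
Qed.

Lemma edge_op_fredholm_det (u : C) :
  is_fredholm_det (fun f => u *: edge_op w_ge0 wW valM f) (psum (det_coef w) u).
Proof.
exists (fun k => u ^+ k * minor_sum w k) => [k|].
  have := @sum_convergesZ _ _ (u ^+ k) _ _ (@minor_sumP _ _ _ _ w_ge0 _ wW _ valM k).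
  rewrite /is_trace_wedge [X in sum_converges X _ -> _](_ : _ =
    @wedge_diag R E (fun f => u *: edge_op w_ge0 wW valM f) k)//.
  by apply/funext => J; rewrite wedge_diag_edge_op.
have r0 : 0 < normc u + 1 by rewrite ltr_wpDl ?normc_ge0.
have cB := det_coef_psbound w_ge0 wW valM r0.
have ur : normc u < normc u + 1 by rewrite ltrDl.
have := sum_converges_series (psumP r0 cB ur).
rewrite [X in series X @ _ --> _ -> _](_ : _ = fun k => (-1) ^+ k * (u ^+ k * minor_sum w k))//.
apply/funext => k; rewrite /det_coef.
have ringE (L : comNzRingType) (x y z : L) : x * y * z = x * (z * y) by ring.
exact: ringE.
Qed.

End Zeta.

Theorem theorem1p6 (R : realType) (V : choiceType) (X : sgraph V)
    (w : OE X -> R) :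
  connected_graph X ->
  bounded_valency X ->
  (forall e, 0 < w e) ->
  (\esum_(e in [set: OE X]) (w e)%:E < +oo)%E ->
  exists T : {linear ell2 R (OE X) -> ell2 R (OE X)},
    [/\ is_edge_operator w T,
        forall S : {linear ell2 R (OE X) -> ell2 R (OE X)},
          is_edge_operator w S -> S =1 T,
        trace_class T &
        exists (P : set R[i]) (Z D : R[i] -> R[i]),
          [/\ meromorphic P Z /\ (forall u, ~ P u -> Z u != 0),
              exists2 r : R, 0 < r & forall u : R[i], Normc.normc u < r ->
                ~ P u /\ prod_converges (@euler_factor V X R w u) (Z u),
              entire D,
              forall u, (~ P u -> D u = (Z u)^-1) /\ (P u -> D u = 0) &
              forall u, is_fredholm_det (fun f => u *: T f) (D u)]].
Proof.
move=> _ [M valM] w_gt0 w_fin.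
have w_ge0 e : 0 <= w e by exact: ltW.
pose W := fine (\esum_(e in [set: OE X]) (w e)%:E).
have wW (F : {fset OE X}) : \sum_(e <- F) w e <= W.
  rewrite -lee_fin fineK ?fset_le_esum// ge0_fin_numE//.
  by apply: esum_ge0 => e _; rewrite lee_fin.
exists (edge_op w_ge0 wW valM); split.
- exact: edge_op_is_edge_operator.
- move=> S hS; apply: edge_operator_unique hS _; exact: edge_op_is_edge_operator.
- exact: edge_op_trace_class.
have cE (rho : R) : 0 < rho -> exists B, psbound (det_coef w) B rho.
  by move=> r0; exists (expR (rho * M%:R * W)); exact: det_coef_psbound.
have c0 : det_coef w 0 = 1 := det_coef0 w_ge0 wW valM.
pose D := psum (det_coef w).
(* At the zeros of [D] the inverse has the conventional value 0; these points are the poles, where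
   the value of [Z] is irrelevant. *)
exists [set u | D u = 0], (fun u => (D u)^-1), D; split.
- split; first by apply: meromorphic_inv_psum => //; rewrite c0 oner_neq0.
  by move=> u /eqP Du; rewrite invr_eq0.
- have [B cB] := cE 1 ltr01.
  have [||e e0 H] := @psum_neq0_near R 1 ltr01 _ B 0 cB; first by rewrite normc0.
    by rewrite (psum0 ltr01 cB) c0 oner_neq0.
  have W1 : 0 < (W + 1)^-1 by rewrite invr_gt0 ltr_wpDl ?(W_ge0 wW).
  (* [e] keeps [D] nonzero near 0, as [D 0 = 1]; [(W + 1)^-1] is the radius in which the partial
     products converge. *)
  exists (Num.min e (W + 1)^-1) => [|u]; first by rewrite lt_min e0.
  rewrite lt_min => /andP[ue uW]; have [|_ Du] := H u; first by rewrite subr0.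
  by split; [exact/eqP|exact: euler_product_converges].
- exact: entire_psum.
- by move=> u; split=> // _; rewrite invrK.
- exact: edge_op_fredholm_det.
Qed.
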